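(* Let $\lambda\in(0,\infty)$ and $\boldsymbol r\in\ell_1^{\downarrow}$. Suppose that $\boldsymbol G_n(0)\to\boldsymbol r$ in probability in $\ell_1^{\downarrow}$, $\lambda_n\to\lambda$ and $d_n\to\infty$ as $n\to\infty$. Then $\boldsymbol G_n\to\boldsymbol g$ in probability in $D([0,\infty):\ell_1^{\downarrow})$ as $n\to\infty$, where $(\boldsymbol g,\boldsymbol v)\in C([0,\infty):\ell_1^{\downarrow}\times\ell_\infty)$ is the unique solution of $$g_i(t)=\Gamma_1\Big(r_i-\int_0^{\cdot}(g_i(s)-g_{i+1}(s))\,ds+v_{i-1}(\cdot)\Big)(t),\quad v_i(t)=\hat\Gamma_1\Big(r_i-\int_0^{\cdot}(g_i(s)-g_{i+1}(s))\,ds+v_{i-1}(\cdot)\Big)(t)$$ for all $i\ge1$, $t\ge0$, with $v_0(t)=\lambda t$.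
   Context: $\ell_p$ is the space of real sequences with finite norm $\|\cdot\|_p$; $\ell_1^{\downarrow}=\{\boldsymbol x\in\ell_1: x_i\ge x_{i+1},\ x_i\in[0,1]\ \forall i\in\mathbb N\}$ with the topology of $\|\cdot\|_1$. $C([0,\infty):S)$, $D([0,\infty):S)$ are the spaces of continuous, respectively right-continuous with left limits, $S$-valued functions; $D$ carries the Skorohod topology. Skorohod map: for $\alpha\in\mathbb R$ and $f\in D([0,\infty):\mathbb R)$ with $f(0)\le\alpha$, $\hat\Gamma_\alpha(f)(t)=\sup_{s\in[0,t]}(f(s)-\alpha)^+$ and $\Gamma_\alpha(f)=f-\hat\Gamma_\alpha(f)$. The model JSQ$(d_n)$: for each $n$ let $\lambda_n>0$ and $d_n\in\{1,\ldots,n\}$. There are $n$ parallel queues, each with a server working at rate 1 (independent exponential(1) service times). Jobs arrive according to a Poisson process of rate $n\lambda_n$; each arriving job selects $d_n$ distinct queues uniformly at random (without replacement) and joins the shortest of them. $G_{n,i}(t)$ is the fraction of queues with at least $i$ jobs at time $t$, $G_{n,0}\equiv1$, and $\boldsymbol G_n(t)=(G_{n,i}(t))_{i\ge1}$; it is assumed that $\boldsymbol G_n(0)\in\ell_1^{\downarrow}$ a.s. Equivalently in distribution, with mutually independent rate-one Poisson processes $N_{i,\pm}$ (independent of $\boldsymbol G_n(0)$), $$G_{n,i}(t)=G_{n,i}(0)-\tfrac1nN_{i,-}\Big(n\int_0^t[G_{n,i}(s)-G_{n,i+1}(s)]ds\Big)+\tfrac1nN_{i,+}\Big(\lambda_nn\int_0^t[\beta_n(G_{n,i-1}(s))-\beta_n(G_{n,i}(s))]ds\Big),$$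 $i\ge1$, where $\beta_n(x)=\prod_{i=0}^{d_n-1}\Big(\frac{x-i/n}{1-i/n}\Big)^+$ for $x\in[0,1]$. *)

(* Defs.v *)
(* Setting: Mathematical Components with MathComp-Analysis. *)
From HB Require Import structures.
From mathcomp Require Import all_boot all_order all_algebra.
From mathcomp Require Import all_classical all_reals all_analysis.

Set Implicit Arguments.
Unset Strict Implicit.
Unset Printing Implicit Defensive.

Import Order.TTheory GRing.Theory Num.Theory.
Import numFieldNormedType.Exports.

Local Open Scope classical_set_scope.
Local Open Scope ring_scope.

(* A real sequence (x_1, x_2, ...) is a function [x : nat -> R] in which [x i]
   stands for x_{i+1}.  The same shift is used for every family indexed by
   i >= 1: the coordinates of G_n, g and v, and the Poisson processes N_{i,-}
   and N_{i,+}. *)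

Section SequenceSpaces.
Context {R : realType}.
Implicit Types (x y : nat -> R) (p : \bar R).

Definition lp_space p : set (nat -> R) :=
  [set x | ('N[counting]_p [EFin \o x] < +oo)%E].

Definition lp_dist p x y : \bar R := ('N[counting]_p [EFin \o (x \- y)%R])%E.

Definition l1_down : set (nat -> R) :=
  [set x | [/\ lp_space 1%E x, forall i, x i.+1 <= x i
                & forall i, 0 <= x i <= 1]].

End SequenceSpaces.

(* Paths are functions on R of which only the values at times t >= 0 matter. *)
Section Paths.
Context {R : realType} {E : Type}.
Variables (S : set E) (dist : E -> E -> \bar R).
Implicit Types f x y : R -> E.

Definition continuous_path f : Prop :=
  forall t : R, 0 <= t ->
    S (f t) /\
    dist (f s) (f t) @[s --> within [set s | 0 <= s] (nbhs t)] --> 0%E.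

Definition cadlag_path f : Prop :=
  [/\ forall t : R, 0 <= t -> S (f t),
      forall t : R, 0 <= t -> dist (f s) (f t) @[s --> t^'+] --> 0%E
    & forall t : R, 0 < t ->
        exists2 l, S l & dist (f s) l @[s --> t^'-] --> 0%E].

(* Strictly increasing maps of [0, oo[ onto itself. *)
Definition time_change : set (R -> R) :=
  [set l | (forall s t : R, 0 <= s -> s < t -> l s < l t) /\
           l @` [set t | 0 <= t] = [set t | 0 <= t]].

Definition log_slope (l : R -> R) : \bar R :=
  ereal_sup [set z | exists s t : R, [/\ 0 <= s, s < t &
                       z = `|ln ((l t - l s) / (t - s))|%:E]].

Definition stopped_dist x y (l : R -> R) (u : R) : \bar R :=
  ereal_sup [set mine (dist (x (Num.min t u)) (y (Num.min (l t) u))) 1%E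
            | t in [set t | 0 <= t]].

(* The metric of the Skorohod J1 topology on D([0, oo[ : S), in the form of
   Ethier and Kurtz, Markov Processes, Section 3.5. *)
Definition skorohod_dist x y : \bar R :=
  ereal_inf [set maxe (log_slope l)
                  (\int[lebesgue_measure]_(u in `[0%R, +oo[)
                     ((expR (- u))%:E * stopped_dist x y l u))%E
            | l in time_change].

End Paths.

Section SkorohodMap.
Context {R : realType}.
Implicit Types (alpha : R) (f : R -> R).

Definition Gamma_hat alpha f (t : R) : R :=
  sup [set Num.max (f s - alpha) 0 | s in [set s | 0 <= s <= t]].

Definition Gamma alpha f (t : R) : R := f t - Gamma_hat alpha f t.

End SkorohodMap.

(* [(P n)^*] is the outer measure extending [P n]: it agrees with [P n] on
   measurable events and spares a measurability proof for the distance. *)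
Definition cvg_in_probability (R : realType) (disp : nat -> measure_display)
    (T : forall n, measurableType (disp n)) (P : forall n, probability (T n) R)
    (E : Type) (dist : E -> E -> \bar R) (X : forall n, T n -> E) (x : E) :
    Prop :=
  forall eps : R, 0 < eps ->
    ((P n)^*%mu [set w | eps%:E < dist (X n w) x])%E @[n --> \oo] --> 0%E.

Section Independence.
Context {R : realType} {disp : measure_display} {T : measurableType disp}.
Variable P : probability T R.

Definition mutually_independent (I : eqType) (F : I -> set (set T)) : Prop :=
  forall (s : seq I) (A : I -> set T), uniq s ->
    (forall i, i \in s -> F i (A i)) ->
    P (\bigcap_(i in [set` s]) A i) = (\prod_(i <- s) P (A i))%E.

Definition sigma_process (J : Type) (D : set J) (disp' : measure_display)
    (V : measurableType disp') (X : J -> T -> V) : set (set T) :=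
  <<s \bigcup_(j in D) preimage_set_system setT (X j) measurable >>.

Definition unit_poisson_process (N : T -> R -> nat) : Prop :=
  [/\ forall t : R, 0 <= t -> measurable_fun setT (fun w => N w t),
      {ae P, forall w, [/\ N w 0 = 0%N,
         forall s t : R, 0 <= s -> s <= t -> (N w s <= N w t)%N
       & forall t : R, 0 <= t -> N w s @[s --> t^'+] --> N w t]},
      forall t : nat -> R, 0 <= t 0%N -> (forall i, t i <= t i.+1) ->
        mutually_independent (fun i => preimage_set_system setT
          (fun w => (N w (t i.+1) - N w (t i))%N) measurable)
    & forall (s t : R) (k : nat), 0 <= s -> s < t ->
        P [set w | (N w t - N w s)%N = k] = (poisson_pmf (t - s) k)%:E].

End Independence.

Section JSQ.
Context {R : realType}.

Definition beta (n d : nat) (x : R) : R :=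
  \prod_(i < d) Num.max ((x - i%:R / n%:R) / (1 - i%:R / n%:R)) 0.

(* G_{n,i} as a function of i >= 0, with G_{n,0} = 1. *)
Definition level (x : nat -> R) (i : nat) : R :=
  if i is j.+1 then x j else 1.

Context {disp : measure_display} {T : measurableType disp}.
Variable P : probability T R.

Definition jsq_equation (n d : nat) (lam : R) (Nm Np : nat -> R -> nat)
    (G : R -> nat -> R) : Prop :=
  forall (i : nat) (t : R), 0 <= t ->
    G t i = G 0 i
      - n%:R^-1 * (Nm i (n%:R *
          \int[lebesgue_measure]_(s in `[0, t]) (G s i - G s i.+1)))%:R
      + n%:R^-1 * (Np i (lam * n%:R *
          \int[lebesgue_measure]_(s in `[0, t])
             (beta n d (level (G s) i) - beta n d (level (G s) i.+1))))%:R.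

Definition jsq_process (n d : nat) (lam : R) (G : T -> R -> nat -> R) : Prop :=
  (forall (t : R) (i : nat), 0 <= t -> measurable_fun setT (fun w => G w t i)) /\
  exists Nm Np : nat -> T -> R -> nat,
    [/\ forall i, unit_poisson_process P (Nm i) /\
                  unit_poisson_process P (Np i),
        mutually_independent P (fun a : option (nat * bool) =>
          match a with
          | None => sigma_process setT (fun i w => G w 0 i)
          | Some (i, b) => sigma_process [set t | 0 <= t]
              (fun t w => (if b then Np else Nm) i w t)
          end)
      & {ae P, forall w,
          [/\ forall i, exists k : nat, G w 0 i = k%:R / n%:R,
              cadlag_path l1_down (lp_dist 1%E) (G w)
            & jsq_equation n d lam (Nm ^~ w) (Np ^~ w) (G w)]}].

End JSQ.

Section FluidLimit.
Context {R : realType}.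
Variables (lam : R) (r : nat -> R).

Definition v_pred (v : R -> nat -> R) (i : nat) (t : R) : R :=
  if i is j.+1 then v t j else lam * t.

Definition free_path (g v : R -> nat -> R) (i : nat) (t : R) : R :=
  r i - \int[lebesgue_measure]_(s in `[0, t]) (g s i - g s i.+1)
    + v_pred v i t.

Definition fluid_solution (g v : R -> nat -> R) : Prop :=
  [/\ continuous_path l1_down (lp_dist 1%E) g,
      continuous_path (lp_space +oo%E) (lp_dist +oo%E) v
    & forall (i : nat) (t : R), 0 <= t ->
        g t i = Gamma 1 (free_path g v i) t /\
        v t i = Gamma_hat 1 (free_path g v i) t].

End FluidLimit.

(* Main.v *)
(* Write V_i(t) = lambda_n int_0^t beta_n(G_{n,i}).  Since beta_n(x) <= x^{d_n}, V_i
   grows only while G_{n,i} is close to 1, so V_i is nearly the regulator of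
   G_{n,i} + V_i, and with the law of large numbers for the driving Poisson
   processes the pair (G_n, V) solves the fluid equations up to an error
   eta 2^i in coordinate i, off an event of small probability.  Such approximate
   solutions are stable in the norm sup_i 2^{-i} |x_i|, by a Gronwall argument in
   the weight e^{24 t}.  Stability gives uniqueness, convergence of each
   coordinate, and existence: good sample paths with errors 2^{-k} form a Cauchy
   sequence whose limit is an exact solution.

   Coordinatewise convergence becomes convergence in l_1 through a uniform tail
   bound.  With probability close to 1, N_i(u) <= A u + z_i for all u >= 0 and all
   relevant i, with sum z_i small when A is large.  One such bound controls the
   total mass, hence G_{n,K} <= 1/2 for a fixed K; then V_K <= lambda_n T 2^{-d_n}
   is negligible, and a second bound, with a larger A and a smaller sum z_i, shows
   that hardly any mass enters the levels beyond K.  The Skorohod distance is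
   bounded by the uniform distance through the identity time change. *)
Require Import Defs.
From HB Require Import structures.
From mathcomp Require Import all_boot all_order all_algebra.
From mathcomp Require Import all_classical all_reals all_analysis.
From mathcomp Require Import measurable_realfun ess_sup_inf lra.
Import Order.TTheory GRing.Theory Num.Theory.
Import numFieldNormedType.Exports.
Local Open Scope classical_set_scope.
Local Open Scope ring_scope.

Set Implicit Arguments.
Unset Strict Implicit.
Unset Printing Implicit Defensive.

(** Instead, each probabilistic statement yields a set of small outer measure off which a
    deterministic estimate holds for a single sample path, and the Poisson thresholds on [n] are
    uniform over all spaces. The weights leave only finitely many coordinates to the law of large
    numbers: beyond a fixed [m] the allowed error [eta * 2 ^+ i] exceeds a trivial bound. They say
    nothing about mass far out, and there the law of large numbers is too weak: the occupied levels
    may be proportional to [n] in number, and errors [delta] in each do not sum to anything small.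
    The substitute is a bound in mean. The excess of a unit Poisson process over a line of slope [A]
    is dominated by a variable of mean at most [8 / A], so [c * n] processes have total excess of
    order [c * n / A], which is small after division by [n] once [A] is large. *)

(** * Integrals over bounded time intervals, and measurability of right-continuous paths *)

Section TimeIntegrals.
Context {R : realType}.
Implicit Types (f : R -> R) (c s t u T : R).
Local Notation mu := (@lebesgue_measure R).

Lemma itv0_measureE t : 0 <= t ->
  mu `[0, t]%classic = t%:E.
Proof.
rewrite le_eqVlt lebesgue_measure_itv /= lte_fin => /predU1P[<-|->].
  by rewrite ltxx.
by rewrite oppr0 addr0.
Qed.

Lemma bounded_integrable (a : itv_bound R) t f c :
  (BLeft 0 <= a)%O ->
  measurable_fun [set` Interval a (BRight t)] f ->
  (forall s, s \in Interval a (BRight t) -> `|f s| <= c) ->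
  mu.-integrable [set` Interval a (BRight t)] (EFin \o f).
Proof.
move=> a0 mf fc; apply: measurable_bounded_integrable => //.
  have sub : [set` Interval a (BRight t)] `<=` `[0, t]%classic.
    by move=> x /=; rewrite !itv_boundlr => /andP[ax ->]; rewrite (le_trans a0).
  apply: le_lt_trans (le_measure mu _ _ sub) _; rewrite ?inE//.
  have [t0|t0] := leP 0 t; first by rewrite /= itv0_measureE// ltry.
  by rewrite set_itv_ge ?measure0 ?ltry// bnd_simp -ltNge.
exists c; split; first exact: num_real.
by move=> x cx s /= sab; apply: le_trans (fc _ sab) (ltW cx).
Qed.

Lemma integrable_itv0 t f c : measurable_fun `[0, t] f ->
  (forall s, 0 <= s <= t -> `|f s| <= c) ->
  mu.-integrable `[0, t] (EFin \o f).
Proof.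
move=> mf fc; exact: (bounded_integrable (c := c)).
Qed.

Lemma measurable_itv0 s t f : s <= t ->
  measurable_fun `[0, t] f -> measurable_fun `[0, s] f.
Proof.
move=> st; apply: measurable_funS => //.
by apply: subset_itvl; rewrite bnd_simp.
Qed.

Lemma norm_Rintegral_le t f c : 0 <= t -> measurable_fun `[0, t] f ->
  (forall s, 0 <= s <= t -> `|f s| <= c) ->
  `|\int[mu]_(s in `[0, t]) f s| <= c * t.
Proof.
move=> t0 mf fc.
have fi := integrable_itv0 mf fc.
apply: le_trans (le_normr_Rintegral _ fi) _ => //.
have -> : c * t = \int[mu]_(s in `[0, t]) c.
  by rewrite Rintegral_cst//= itv0_measureE.
apply: le_Rintegral => //.
- apply: (integrable_itv0 (c := c)); first exact: measurableT_comp.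
  by move=> s /fc; rewrite normr_id.
- exact: (integrable_itv0 (c := `|c|)).
Qed.

(** One time integration of the weight [expR (L * s)] gains a factor [1 / L]; this is the
    contraction behind the Gronwall argument. *)
Lemma Rintegral_expR_le (L t : R) : 0 < L -> 0 <= t ->
  \int[mu]_(s in `[0, t]) expR (L * s) <= expR (L * t) / L.
Proof.
move=> L0; rewrite le_eqVlt => /predU1P[<-|t0].
  rewrite set_itv1 Rintegral_set1 divr_ge0 ?expR_ge0 ?ltW//.
pose F s := expR (L * s) / L.
have dF (x : R) : is_derive x 1 F (expR (L * x)).
  rewrite /F; apply: is_derive_eq.
  by rewrite /GRing.scale/= !mulr0 !mulr1 add0r mulrCA mulVf ?mulr1// gt_eqF.
have cF : continuous F.
  by move=> x; apply: differentiable_continuous; apply/derivable1_diffP; case: (dF x).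
rewrite /Rintegral (@continuous_FTC2 _ _ F)//=.
- by rewrite /F mulr0 expR0 lerBlDr lerDl divr_ge0// ltW.
- apply: continuous_subspaceT => x.
  apply: continuous_comp; first exact: mulrl_continuous.
  exact: continuous_expR.
- split.
  + by move=> x _; case: (dF x).
  + by apply: cvg_at_right_filter; exact: cF.
  + by apply: cvg_at_left_filter; exact: cF.
- by move=> x _; rewrite derive1E; case: (dF x).
Qed.

Lemma norm_Rintegral_expR_le (L B t : R) f : 0 < L -> 0 <= B -> 0 <= t ->
  measurable_fun `[0, t] f ->
  (forall s, 0 <= s <= t -> `|f s| <= B * expR (L * s)) ->
  `|\int[mu]_(s in `[0, t]) f s| <= B * (expR (L * t) / L).
Proof.
move=> L0 B0 t0 mf fB.
have fB' s : 0 <= s <= t -> `|f s| <= B * expR (L * t).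
  move=> /[dup] /fB /le_trans + /andP[s0 st]; apply.
  by rewrite ler_wpM2l// ler_expR ler_pM2l.
have mE : measurable_fun `[0, t] (fun s : R => expR (L * s)).
  by apply: measurable_funTS; apply: measurableT_comp => //; exact: mulrl_measurable.
have iE : mu.-integrable `[0, t] (EFin \o (fun s : R => expR (L * s))).
  apply: (integrable_itv0 (c := expR (L * t))) => // s /andP[s0 st].
  by rewrite ger0_norm ?expR_ge0// ler_expR ler_pM2l.
apply: le_trans (le_normr_Rintegral _ (integrable_itv0 mf fB')) _ => //.
apply: (@le_trans _ _ (\int[mu]_(s in `[0, t]) (B * expR (L * s)))).
  apply: le_Rintegral => //.
  - apply: (integrable_itv0 (c := B * expR (L * t))); first exact: measurableT_comp.
    by move=> s /fB'; rewrite normr_id.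
  - apply: (integrable_itv0 (c := B * expR (L * t))); first exact: measurable_funM.
    move=> s /andP[s0 st]; rewrite ger0_norm ?mulr_ge0 ?expR_ge0//.
    by rewrite ler_wpM2l// ler_expR ler_pM2l.
by rewrite RintegralZl// ler_wpM2l// Rintegral_expR_le.
Qed.

(** The sharp bounds on [f] are asked on []s, t]] only, because the regulator estimate starts from a
    last exit time [s] at which [G] may still be close to 1. *)
Lemma Rintegral_increment_bounds (s t a b : R) f (M : R) :
  0 <= s -> s <= t -> measurable_fun `[0, t] f ->
  (forall u, 0 <= u <= t -> `|f u| <= M) ->
  (forall u, s < u <= t -> a <= f u <= b) ->
  a * (t - s) <=
    \int[mu]_(u in `[0, t]) f u - \int[mu]_(u in `[0, s]) f u <= b * (t - s).
Proof.
move=> s0 st mf fM fab.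
have fi := integrable_itv0 mf fM.
rewrite Rintegral_itvB// ?bnd_simp//.
have sub : `]s, t] `<=` `[0, t].
  by apply: subset_itvr; rewrite bnd_simp.
have fi' : mu.-integrable `]s, t] (EFin \o f) by apply: integrableS fi.
have E (c : R) : c * (t - s) = \int[mu]_(u in `]s, t]) c.
  rewrite Rintegral_cst//= lebesgue_measure_itv /= lte_fin.
  by move: st; rewrite le_eqVlt => /predU1P[->|->//]; rewrite ltxx subrr.
have ci (c : R) : mu.-integrable `]s, t] (EFin \o (fun=> c)).
  by apply: (bounded_integrable (c := `|c|)) => //; rewrite bnd_simp.
by apply/andP; split; rewrite E; apply: le_Rintegral => // u /=;
  rewrite in_itv /= => /fab /andP[].
Qed.

Lemma right_continuous_measurable f T :
  (forall s, 0 <= s -> f x @[x --> s^'+] --> f s) ->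
  measurable_fun `[0, T] f.
Proof.
move=> cf.
(* [u n s] is the first point of the grid [k / n.+1] strictly to the right of [s]: [f \o u n] takes
   countably many values, and right continuity gives its limit [f s]. *)
pose u n (s : R) : R := (Num.truncn (n.+1%:R * s)).+1%:R / n.+1%:R.
have u_gt n s : s < u n s.
  by rewrite /u ltr_pdivlMr// mulrC; exact: truncnS_gt.
have u_le n s : 0 <= s -> u n s <= s + n.+1%:R^-1.
  move=> s0; rewrite /u ler_pdivrMr// mulrDl mulVf// -natr1 lerD2r mulrC.
  by rewrite truncn_le mulr_ge0.
apply: (@measurable_fun_cvg _ _ _ _ (fun n s => f (u n s))) => [n|s]; last first.
  rewrite /= in_itv /= => /andP[s0 _].
  have /cvg_at_rightP := cf s s0; apply; split => //.
  apply: (@squeeze_cvgr _ _ _ _ (fun=> s) (fun n => s + n.+1%:R^-1)).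
  - by near=> n; rewrite ltW//= u_le.
  - exact: cvg_cst.
  - rewrite -[X in _ --> X]addr0; apply: cvgD; first exact: cvg_cst.
    exact: cvg_harmonic.
move=> mD Y mY.
have -> : `[0, T] `&` (fun s => f (u n s)) @^-1` Y =
  \bigcup_(k in [set k | Y (f (k.+1%:R / n.+1%:R))])
    (`[0, T] `&` `[k%:R / n.+1%:R, k.+1%:R / n.+1%:R[).
  apply/seteqP; split => [s [sT Ys]|s [k Yk [sT]]].
    exists (Num.truncn (n.+1%:R * s)) => //; split => //=.
    have s0 : 0 <= s by move: sT; rewrite /= in_itv /= => /andP[].
    rewrite in_itv /= (u_gt n s) andbT ler_pdivrMr// mulrC truncn_le.
    by rewrite mulr_ge0.
  rewrite /= in_itv /= => /andP[ks sk]; split => //=.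
  rewrite /u (@truncn_def _ _ k)//.
  by rewrite mulrC -ler_pdivrMr// ks -ltr_pdivlMr.
by apply: bigcup_measurable => k _; exact: measurableI.
Unshelve. all: by end_near. Qed.

End TimeIntegrals.

(** * The regulator: bounds, Lipschitz continuity, approximate reflection *)

Section SkorohodMapFacts.
Context {R : realType}.
Implicit Types (f g : R -> R) (alpha c s t u x : R).

Lemma Gamma_hat_le alpha f t c : 0 <= t -> 0 <= c ->
  (forall s, 0 <= s <= t -> f s - alpha <= c) -> Gamma_hat alpha f t <= c.
Proof.
move=> t0 c0 fc; apply: ge_sup.
  by exists (Num.max (f 0 - alpha) 0); exists 0 => //=; rewrite lexx.
by move=> _ [s /= /fc fsc <-]; rewrite ge_max fsc.
Qed.

(** The bound [M] guarantees a genuine supremum, since [sup] of an unbounded set is a default value.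
    The same reason explains the upper bounds carried by the statements below. *)
Lemma Gamma_hat_ge alpha f t (M : R) s : (forall s, 0 <= s <= t -> f s <= M) ->
  0 <= s <= t -> Num.max (f s - alpha) 0 <= Gamma_hat alpha f t.
Proof.
move=> fM st; apply: ub_le_sup; last by exists s.
exists (Num.max (M - alpha) 0) => _ [u /= /fM fuM <-].
by rewrite ge_max !le_max lexx orbT andbT lerD2r fuM.
Qed.

Lemma Gamma_hat_ge0 alpha f t (M : R) : 0 <= t ->
  (forall s, 0 <= s <= t -> f s <= M) -> 0 <= Gamma_hat alpha f t.
Proof.
move=> t0 fM; apply: le_trans (Gamma_hat_ge alpha fM (s := 0) _).
  by rewrite le_max lexx orbT.
by rewrite lexx.
Qed.

Lemma Gamma_hat_lipschitz1 alpha f g t c (M : R) : 0 <= t ->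
  (forall s, 0 <= s <= t -> g s <= M) ->
  (forall s, 0 <= s <= t -> f s <= g s + c) -> 0 <= c ->
  Gamma_hat alpha f t <= Gamma_hat alpha g t + c.
Proof.
move=> t0 gM fg c0; apply: Gamma_hat_le => //.
  by rewrite addr_ge0// (Gamma_hat_ge0 _ t0 gM).
move=> s st; apply: (@le_trans _ _ (g s - alpha + c)).
  by rewrite addrAC lerD2r fg.
rewrite lerD2r; apply: le_trans (Gamma_hat_ge alpha gM st).
by rewrite le_max lexx.
Qed.

Lemma Gamma_hat_lipschitz alpha f g t c (M : R) : 0 <= t ->
  (forall s, 0 <= s <= t -> g s <= M) ->
  (forall s, 0 <= s <= t -> `|f s - g s| <= c) ->
  `|Gamma_hat alpha f t - Gamma_hat alpha g t| <= c.
Proof.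
move=> t0 gM fg.
have c0 : 0 <= c by apply: le_trans (fg 0 _); rewrite ?lexx.
have fg' s : 0 <= s <= t -> f s <= g s + c /\ g s <= f s + c.
  by move=> /fg; rewrite ler_norml => /andP[]; lra.
have h1 := Gamma_hat_lipschitz1 alpha t0 gM (fun s st => (fg' s st).1) c0.
have fM s : 0 <= s <= t -> f s <= M + c.
  by move=> st; have := (fg' s st).1; have := gM s st; lra.
have h2 := Gamma_hat_lipschitz1 alpha t0 fM (fun s st => (fg' s st).2) c0.
by rewrite ler_norml; lra.
Qed.

(* Approximate reflection: if [V] moves by at most [e] over any stretch on which
   [G <= 1 - e], then [V] is within [2 * e] of the regulator of [G + V]. *)
Lemma Gamma_hat_approx (G V : R -> R) (e L t : R) :
  0 <= t -> 0 < e -> 0 <= L -> V 0 = 0 ->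
  (forall s u, 0 <= s -> s <= u -> u <= t -> 0 <= V u - V s <= L * (u - s)) ->
  (forall s, 0 <= s <= t -> G s <= 1) ->
  (forall s u, 0 <= s -> s <= u -> u <= t ->
     (forall x, s < x <= u -> G x <= 1 - e) -> V u - V s <= e) ->
  `|V t - Gamma_hat 1 (fun s => G s + V s) t| <= 2 * e.
Proof.
move=> t0 e0 L0 V0 Vinc G1 Vflat.
have Vmon s : 0 <= s <= t -> V s <= V t.
  by move=> /andP[s0 st]; have := Vinc s t s0 st (lexx _); lra.
have Vt0 : 0 <= V t by have := Vmon 0; rewrite V0 lexx t0; apply.
have XM s : 0 <= s <= t -> G s + V s <= 1 + V t.
  by move=> st; rewrite lerD ?G1 ?Vmon.
have up : Gamma_hat 1 (fun s => G s + V s) t <= V t.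
  by apply: Gamma_hat_le => // s st; have := XM s st; lra.
suff low : V t <= Gamma_hat 1 (fun s => G s + V s) t + 2 * e.
  by rewrite ler_norml; lra.
(* [sup S] is the last time at which [G] exceeds [1 - e]. At points of [S] the regulator is at least
   [V s - e], and after [sup S] the path [V] gains at most [e]; hence [2 * e]. *)
pose S := [set s | 0 <= s <= t /\ 1 - e < G s].
have [S0|/set0P Sn0] := eqVneq S set0.
  have : V t - V 0 <= e.
    apply: Vflat => // x /andP[x0 xt]; rewrite leNgt; apply/negP => Gx.
    suff : S x by rewrite S0.
    by split => //; rewrite (ltW x0).
  rewrite V0; have := Gamma_hat_ge0 1 t0 XM; lra.
have Sub : has_ubound S by exists t => s [/andP[]].
have St : sup S <= t by apply: ge_sup => // s [/andP[]].
have S0 : 0 <= sup S.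
  by case: Sn0 => s Ss; apply: le_trans (ub_le_sup Sub Ss); case: Ss => /andP[].
apply/ler_addgt0Pr => d d0.
(* [sup S] need not belong to [S]; a point of [S] within [d / (L + 1)] of it costs at most [d] by
   the Lipschitz bound. [L + 1] avoids dividing by zero. *)
have dL : 0 < d / (L + 1) by rewrite divr_gt0// ltr_wpDl.
have [s Ss sd] := sup_adherent dL (conj Sn0 Sub).
have sS := ub_le_sup Sub Ss.
case: Ss => /andP[s0 st] Gs.
have h1 : V t - V (sup S) <= e.
  apply: Vflat => // x /andP[x0 xt]; rewrite leNgt; apply/negP => Gx.
  have /(ub_le_sup Sub) : S x by split => //; rewrite (le_trans S0 (ltW x0)).
  by rewrite leNgt x0.
have h2 : V (sup S) - V s <= d.
  have /andP[_ /le_trans] := Vinc _ _ s0 sS St; apply.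
  rewrite -(@ler_pM2l _ (L + 1)^-1) ?invr_gt0 ?ltr_wpDl//.
  have {}sd : sup S - s <= d / (L + 1) by lra.
  apply: (@le_trans _ _ (sup S - s)); last by rewrite mulrC.
  rewrite mulrA -[leRHS]mul1r ler_wpM2r ?subr_ge0//.
  by rewrite mulrC ler_pdivrMr ?ltr_wpDl// mul1r lerDl.
have st' : 0 <= s <= t by rewrite s0.
have := Gamma_hat_ge 1 XM st'; rewrite ge_max => /andP[]; lra.
Qed.

End SkorohodMapFacts.

(** * The distances of l_1 and l_oo through partial sums and coordinates *)

Section SequenceDistances.
Context {R : realType}.
Implicit Types (x y : nat -> R) (c : R).

Lemma lp_dist1E x y :
  lp_dist 1%E x y = (\sum_(0 <= i <oo) `|x i - y i|%:E)%E.
Proof.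
by rewrite /lp_dist Lnorm1 ge0_integral_count// => k; rewrite abse_ge0.
Qed.

Lemma lp_dist_ge0 p x y : (0 <= lp_dist p x y)%E.
Proof. exact: Lnorm_ge0. Qed.

Lemma partial_sum_le_lp_dist1 x y n :
  ((\sum_(0 <= i < n) `|x i - y i|)%:E <= lp_dist 1%E x y)%E.
Proof.
rewrite lp_dist1E -sumEFin; apply: nneseries_lim_ge => k _.
by rewrite lee_fin.
Qed.

Lemma coord_le_lp_dist1 x y i : (`|x i - y i|%:E <= lp_dist 1%E x y)%E.
Proof.
apply: le_trans (partial_sum_le_lp_dist1 x y i.+1).
by rewrite lee_fin big_nat_recr//= lerDr sumr_ge0.
Qed.

Lemma lp_dist1_le x y c :
  (forall n, \sum_(0 <= i < n) `|x i - y i| <= c) -> (lp_dist 1%E x y <= c%:E)%E.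
Proof.
move=> xyc; rewrite lp_dist1E; apply: lime_le.
  by apply: is_cvg_nneseries => k _ _; rewrite lee_fin.
by apply: nearW => n /=; rewrite sumEFin lee_fin.
Qed.

Lemma lp_dist_oo_le x y c :
  (forall i, `|x i - y i| <= c) -> (lp_dist +oo%E x y <= c%:E)%E.
Proof.
move=> xyc; rewrite /lp_dist unlock; case: ifPn => [_|_]; last first.
  by rewrite lee_fin; apply: le_trans (xyc 0%N).
by apply/ess_supP/nearW => i /=; rewrite lee_fin.
Qed.

Lemma lp_space1_le x c : (forall n, \sum_(0 <= i < n) `|x i| <= c) ->
  lp_space 1%E x.
Proof.
move=> xc; have := @lp_dist1_le x (fun=> 0) c.
rewrite /lp_dist /lp_space /=.
have -> : EFin \o (x \- (fun=> 0))%R = EFin \o x.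
  by apply/funext => i /=; rewrite subr0.
move=> /(_ _) /le_lt_trans; apply; last exact: ltry.
by move=> n; under eq_bigr do rewrite subr0; exact: xc.
Qed.

Lemma lp_space_oo_le x c : (forall i, `|x i| <= c) -> lp_space +oo%E x.
Proof.
move=> xc; have := @lp_dist_oo_le x (fun=> 0) c.
rewrite /lp_dist /lp_space /=.
have -> : EFin \o (x \- (fun=> 0))%R = EFin \o x.
  by apply/funext => i /=; rewrite subr0.
move=> /(_ _) /le_lt_trans; apply; last exact: ltry.
by move=> n; rewrite subr0; exact: xc.
Qed.

Lemma lp_space1_sum x : lp_space 1%E x ->
  exists2 c : R, 0 <= c & forall n, \sum_(0 <= i < n) `|x i| <= c.
Proof.
have -> : lp_space 1%E x = (lp_dist 1%E x (fun=> 0%R) < +oo)%E.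
  rewrite /lp_dist /lp_space /=; congr (is_true (Lnorm _ _ _ < _)%E).
  by apply/funext => i /=; rewrite subr0.
move=> xoo; have x_fin : lp_dist 1%E x (fun=> 0) \is a fin_num.
  by rewrite ge0_fin_numE ?lp_dist_ge0.
exists (fine (lp_dist 1%E x (fun=> 0))); first by rewrite fine_ge0 ?lp_dist_ge0.
move=> n; rewrite -lee_fin fineK//.
have := partial_sum_le_lp_dist1 x (fun=> 0) n.
by under eq_bigr do rewrite subr0.
Qed.

Lemma lp_space1_tail x (e : R) : lp_space 1%E x -> 0 < e ->
  exists N, forall n m, (N <= n)%N -> \sum_(n <= i < m) `|x i| <= e.
Proof.
move=> /lp_space1_sum[c _ xc] e0.
have : cvgn (series (fun i => `|x i|)).
  apply: nondecreasing_is_cvgn.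
    by apply/nondecreasing_series => n _ _.
  by exists c => _ [n _ <-]; exact: xc.
move=> /cauchy_cvgP /cauchy_seriesP /(_ e e0) [[A B] /= [[N1 _ HA] [N2 _ HB]] AB].
exists (maxn N1 N2) => n m; rewrite geq_max => /andP[N1n N2n].
have [nm|mn] := leqP n m; last by rewrite big_geq ?ltW// ltnW.
have : `|\sum_(n <= i < m) `|x i| | < e.
  by apply: (AB (n, m)); split; [exact: HA|apply: HB; exact: leq_trans nm].
by rewrite ger0_norm ?sumr_ge0// => /ltW.
Qed.

Lemma coord_cvg (U : Type) (F : set_system U) (FF : Filter F)
    (f : U -> nat -> R) (x : nat -> R) i :
  (lp_dist 1%E (f s) x @[s --> F] --> 0)%E -> f s i @[s --> F] --> x i.
Proof.
move=> fx; apply/cvgrPdist_le => e e0.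
have /cvgrPdist_le : (fun s => `|f s i - x i|) @ F --> (0 : R).
  have : (`|f s i - x i|%:E @[s --> F] --> 0)%E.
    apply: squeeze_cvge fx; last exact: cvg_cst.
    by apply: nearW => s; rewrite lee_fin normr_ge0/= coord_le_lp_dist1.
  by move=> /fine_cvg.
move=> /(_ e e0); apply: filterS => s.
by rewrite sub0r normrN normr_id distrC.
Qed.

End SequenceDistances.

(** * Approximate fluid solutions: stability, perturbation, uniqueness *)

Section ApproximateSolutions.
Context {R : realType}.
Implicit Types (lam T eta t s : R) (r : nat -> R) (G V g v : R -> nat -> R).
Local Notation mu := (@lebesgue_measure R).

(* The weights [2 ^+ i] let the coupling of coordinate [i] with its neighbours
   [i.-1] and [i.+1] cost only a constant factor. *)
Definition approx_solution lam r T eta G V : Prop :=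
  [/\ forall i, measurable_fun `[0, T] (G ^~ i),
      forall i t, 0 <= t <= T -> 0 <= G t i <= 1,
      forall i, exists M : R, forall t, 0 <= t <= T -> `|V t i| <= M,
      forall i t, 0 <= t <= T ->
        `|G t i - (free_path lam r G V i t - V t i)| <= eta * 2 ^+ i
    & forall i t, 0 <= t <= T ->
        `|V t i - Gamma_hat 1 (free_path lam r G V i) t| <= eta * 2 ^+ i].

Lemma outflow_integrable T G i t :
  (forall i, measurable_fun `[0, T] (G ^~ i)) ->
  (forall i t, 0 <= t <= T -> 0 <= G t i <= 1) -> t <= T ->
  mu.-integrable `[0, t] (EFin \o (fun s => G s i - G s i.+1)).
Proof.
move=> mG G01 tT; apply: (integrable_itv0 (c := 1)).
  by apply: measurable_funB; apply: measurable_itv0 tT _.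
move=> s /andP[s0 st]; have sT : 0 <= s <= T by rewrite s0 (le_trans st).
by have := G01 i s sT; have := G01 i.+1 s sT; rewrite ler_norml; lra.
Qed.

Lemma outflow_le T G i t :
  (forall i, measurable_fun `[0, T] (G ^~ i)) ->
  (forall i t, 0 <= t <= T -> 0 <= G t i <= 1) -> 0 <= t <= T ->
  `|\int[mu]_(s in `[0, t]) (G s i - G s i.+1)| <= t.
Proof.
move=> mG G01 /andP[t0 tT]; rewrite -[leRHS]mul1r; apply: norm_Rintegral_le => //.
  by apply: measurable_funB; apply: measurable_itv0 tT _.
move=> s /andP[s0 st]; have sT : 0 <= s <= T by rewrite s0 (le_trans st).
by have := G01 i s sT; have := G01 i.+1 s sT; rewrite ler_norml; lra.
Qed.

(** Supplies the upper bound under which [Gamma_hat] of a free path is a genuine supremum. *)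
Lemma free_path_le lam r T G V i t (M : R) :
  (forall i, measurable_fun `[0, T] (G ^~ i)) ->
  (forall i t, 0 <= t <= T -> 0 <= G t i <= 1) ->
  0 <= t <= T -> `|v_pred lam V i t| <= M ->
  free_path lam r G V i t <= `|r i| + T + M.
Proof.
move=> mG G01 tT vM; rewrite /free_path.
have := outflow_le i mG G01 tT; case/andP: tT => t0 tT.
have := ler_norm (r i); move: vM; rewrite !ler_norml.
by move=> /andP[_ +] + /andP[+ _]; lra.
Qed.

Lemma v_pred_bounded lam T V : 0 <= T ->
  (forall i, exists M : R, forall t, 0 <= t <= T -> `|V t i| <= M) ->
  forall i, exists M : R, forall t, 0 <= t <= T -> `|v_pred lam V i t| <= M.
Proof.
move=> T0 VM [|i] //=; exists (`|lam| * T) => t /andP[t0 tT].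
by rewrite normrM (ger0_norm t0) ler_wpM2l.
Qed.

Lemma approx_solution_ge0 lam r T eta G V : 0 <= T ->
  approx_solution lam r T eta G V -> 0 <= eta.
Proof.
move=> T0 [_ _ _ H _]; rewrite -[eta]mulr1 -(expr0 2).
by apply: le_trans (H 0%N 0 _) => //; rewrite lexx.
Qed.

(** The factor 3 is [1 + 2]: the neighbour [i.+1] carries twice the weight of [i]. *)
Lemma outflow_diff_le T G G' i t (B L : R) : 0 < L -> 0 <= B ->
  (forall i, measurable_fun `[0, T] (G ^~ i)) ->
  (forall i, measurable_fun `[0, T] (G' ^~ i)) ->
  (forall i t, 0 <= t <= T -> 0 <= G t i <= 1) ->
  (forall i t, 0 <= t <= T -> 0 <= G' t i <= 1) ->
  (forall i t, 0 <= t <= T -> `|G t i - G' t i| <= B * 2 ^+ i * expR (L * t)) ->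
  0 <= t <= T ->
  `|\int[mu]_(s in `[0, t]) (G s i - G s i.+1)
    - \int[mu]_(s in `[0, t]) (G' s i - G' s i.+1)|
  <= 3 * B * 2 ^+ i * (expR (L * t) / L).
Proof.
move=> L0 B0 mG mG' G01 G01' GB /andP[t0 tT].
have fB (s : R) : 0 <= s <= t ->
    `|(G s i - G s i.+1) - (G' s i - G' s i.+1)| <= 3 * B * 2 ^+ i * expR (L * s).
  move=> /andP[s0 st]; have sT : 0 <= s <= T by rewrite s0 (le_trans st).
  have := GB i s sT; have := GB i.+1 s sT; rewrite exprS !ler_norml.
  set E := expR _; set p := 2 ^+ i.
  have -> : B * (2 * p) * E = 2 * (B * p * E) by lra.
  have -> : 3 * B * p * E = 3 * (B * p * E) by lra.
  lra.
rewrite -RintegralB//; [|exact: outflow_integrable tT..].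
apply: norm_Rintegral_expR_le => //.
  by rewrite !mulr_ge0// exprn_ge0.
by apply: measurable_funB; apply: measurable_funB; apply: measurable_itv0 tT _.
Qed.

(* The weight [expR (24 * t)] divides the integral term by 24, so that a bound [B]
   improves to [B / 2] up to the errors; iterating removes the initial bound. *)
Lemma stability_step lam r T eta eta' G V G' V' (B : R) : 0 <= T ->
  approx_solution lam r T eta G V -> approx_solution lam r T eta' G' V' ->
  0 <= B ->
  (forall i t, 0 <= t <= T -> `|G t i - G' t i| <= B * 2 ^+ i * expR (24 * t)) ->
  let q t := B / 8 * expR (24 * t) + (eta + eta') in
  forall i t, 0 <= t <= T ->
    `|v_pred lam V i t - v_pred lam V' i t| <= q t * 2 ^+ i /\
    `|G t i - G' t i| <= 4 * q t * 2 ^+ i.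
Proof.
move=> T0 aG aG' B0 GB q.
have eta0 := approx_solution_ge0 T0 aG; have eta'0 := approx_solution_ge0 T0 aG'.
case: aG aG' => [mG G01 VM HG HV] [mG' G01' VM' HG' HV'].
have q0 t : 0 <= q t by rewrite !addr_ge0// mulr_ge0 ?divr_ge0// expR_ge0.
have qmon s t : s <= t -> q s <= q t.
  by move=> st; rewrite lerD2r ler_wpM2l ?divr_ge0// ler_expR ler_pM2l.
have p0 i : 0 <= 2 ^+ i :> R by rewrite exprn_ge0.
(* The induction on [i] closes without loss. In units of [2 ^+ i], the integral costs
   [q - (eta + eta')], the incoming [v_pred] costs [q], and the two reflection errors add
   [eta + eta'], so the difference of [V] is [2 * q]: exactly the claim for [v_pred] at [i.+1]. The
   difference of [G] collects [4 * q]. *)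
have HF i t : 0 <= t <= T ->
    `|v_pred lam V i t - v_pred lam V' i t| <= q t * 2 ^+ i ->
    `|free_path lam r G V i t - free_path lam r G' V' i t|
      <= (2 * q t - (eta + eta')) * 2 ^+ i.
  move=> tT; rewrite /free_path.
  have L0 : (0 : R) < 24 by [].
  have := outflow_diff_le i L0 B0 mG mG' G01 G01' GB tT.
  have -> : 3 * B * 2 ^+ i * (expR (24 * t) / 24) =
            (q t - (eta + eta')) * 2 ^+ i :> R by rewrite /q; lra.
  rewrite !ler_norml; lra.
have HVV i : (forall t, 0 <= t <= T ->
      `|v_pred lam V i t - v_pred lam V' i t| <= q t * 2 ^+ i) ->
    forall t, 0 <= t <= T -> `|V t i - V' t i| <= q t * 2 ^+ i.+1.
  move=> IH t /[dup] tT /andP[t0 tT'].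
  have [M vM] := v_pred_bounded lam T0 VM' i.
  have sub s : 0 <= s <= t -> 0 <= s <= T.
    by move=> /andP[-> /le_trans]; apply.
  have : `|Gamma_hat 1 (free_path lam r G V i) t
      - Gamma_hat 1 (free_path lam r G' V' i) t|
      <= (2 * q t - (eta + eta')) * 2 ^+ i.
    apply: (@Gamma_hat_lipschitz _ 1 _ _ _ _ (`|r i| + T + M)) => // s st.
      exact: free_path_le (sub _ st) (vM _ (sub _ st)).
    apply: le_trans (HF _ _ (sub _ st) (IH _ (sub _ st))) _.
    by rewrite ler_wpM2r// lerD2r ler_pM2l// qmon//; case/andP: st.
  have := HV i t tT; have := HV' i t tT; rewrite exprS !ler_norml; lra.
have main i : forall t, 0 <= t <= T ->
    `|v_pred lam V i t - v_pred lam V' i t| <= q t * 2 ^+ i.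
  elim: i => [t _|i IH t tT] /=; first by rewrite subrr normr0 mulr_ge0.
  exact: HVV.
move=> i t tT; split; first exact: main.
have := HF i t tT (main i t tT); have := HVV i (main i) t tT.
have := HG i t tT; have := HG' i t tT; rewrite exprS !ler_norml; lra.
Qed.

(** With [a = eta + eta'], one step maps a bound [B] to [B / 2 + 4 * a], whose fixed point is
    [8 * a]. Starting from the trivial bound 1, [k] steps give [8 * a + 2 ^- k], and [k] tends to
    infinity. *)
Lemma stability lam r T eta eta' G V G' V' : 0 <= T ->
  approx_solution lam r T eta G V -> approx_solution lam r T eta' G' V' ->
  forall i t, 0 <= t <= T ->
    `|G t i - G' t i| <= 8 * expR (24 * T) * (eta + eta') * 2 ^+ i /\
    `|V t i - V' t i| <= 8 * expR (24 * T) * (eta + eta') * 2 ^+ i.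
Proof.
move=> T0 aG aG'.
have eta0 := approx_solution_ge0 T0 aG; have eta'0 := approx_solution_ge0 T0 aG'.
set a := eta + eta'; have a0 : 0 <= a by rewrite addr_ge0.
have p0 i : 0 < 2 ^+ i :> R by rewrite exprn_gt0.
have E1 t : 0 <= t -> 1 <= expR (24 * t) :> R by move=> t0; rewrite -expR0 ler_expR mulr_ge0.
have Bk k : forall i t, 0 <= t <= T ->
    `|G t i - G' t i| <= (8 * a + 2 ^- k) * 2 ^+ i * expR (24 * t).
  elim: k => [|k IH] i t /[dup] tT /andP[t0 _].
    apply: (@le_trans _ _ 1).
      have [_ G01 _ _ _] := aG; have [_ G01' _ _ _] := aG'.
      have := G01 i t tT; have := G01' i t tT; rewrite ler_norml; lra.
    rewrite -[leLHS]mulr1 ler_pM ?E1// expr0 invr1 -[leLHS]mulr1 ler_pM//.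
      by rewrite lerDr mulr_ge0.
    by rewrite exprn_ege1// ler1n.
  have B0 : 0 <= 8 * a + 2 ^- k by rewrite addr_ge0 ?mulr_ge0 ?invr_ge0 ?exprn_ge0.
  have [_] := stability_step T0 aG aG' B0 IH i tT; move/le_trans; apply.
  rewrite -/a [leRHS]mulrAC ler_pM2r//.
  have -> : 2 ^- k.+1 = 2 ^- k / 2 :> R by rewrite exprS invfM mulrC.
  have := E1 t t0; set E := expR _; set w := 2 ^- k => E1t.
  have : a <= a * E by rewrite ler_peMr.
  lra.
have GB i t : 0 <= t <= T -> `|G t i - G' t i| <= 8 * a * 2 ^+ i * expR (24 * t).
  move=> tT; apply/ler_addgt0Pr => e e0.
  have half : `|2^-1 : R| < 1 by rewrite ger0_norm ?invr_ge0// invf_lt1// ltr1n.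
  have /cvgrPdist_lt/(_ e e0)[k _ /(_ k)] :=
    cvg_geometric (2 ^+ i * expR (24 * t)) half.
  rewrite /= leqnn sub0r normrN ger0_norm; last first.
    by rewrite mulr_ge0 ?exprn_ge0 ?invr_ge0// mulr_ge0 ?expR_ge0// ltW.
  move=> /(_ isT)/ltW ke; apply: le_trans (Bk k i t tT) _.
  by rewrite mulrDl mulrDl lerD2l -mulrA mulrC -exprVn.
have B0 : 0 <= 8 * a by rewrite mulr_ge0.
have mE t : t <= T -> expR (24 * t) <= expR (24 * T) by move=> tT; rewrite ler_expR ler_pM2l.
move=> i t tT; split.
  apply: le_trans (GB i t tT) _; rewrite mulrAC ler_pM2r// [leRHS]mulrAC.
  by case/andP: tT => _ tT; rewrite ler_wpM2l ?mulr_ge0// mE.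
(* The step is applied at [i.+1] because [v_pred] at [i.+1] is [V] at [i]. *)
have [+ _] := stability_step T0 aG aG' B0 GB i.+1 tT; move/le_trans; apply.
rewrite exprS -/a; case/andP: tT => t0 tT.
have := mE t tT; have := E1 t t0.
set E := expR _; set E' := expR _ => E1t EE.
rewrite mulrA ler_pM2r//.
have : a * E <= a * E' by rewrite ler_wpM2l.
have : a <= a * E by rewrite ler_peMr.
lra.
Qed.

(** Lets a limit inherit the equations from its approximants. The integral changes by [3 * T * eta']
    and [v_pred] by [eta']; the changes of [G] and [V] themselves account for the other
    [2 * eta']. *)
Lemma approx_solution_perturb lam r T eta eta' G V g v : 0 <= T ->
  approx_solution lam r T eta G V ->
  (forall i, measurable_fun `[0, T] (g ^~ i)) ->
  (forall i t, 0 <= t <= T -> 0 <= g t i <= 1) ->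
  (forall i t, 0 <= t <= T -> `|G t i - g t i| <= eta' * 2 ^+ i) ->
  (forall i t, 0 <= t <= T -> `|V t i - v t i| <= eta' * 2 ^+ i) ->
  approx_solution lam r T (eta + (3 + 3 * T) * eta') g v.
Proof.
move=> T0 [mG G01 VM HG HV] mg g01 Gg Vv.
have e0 : 0 <= eta'.
  by rewrite -[eta']mulr1 -(expr0 2); apply: le_trans (Gg 0%N 0 _) => //; rewrite lexx.
have p0 i : 0 < 2 ^+ i :> R by rewrite exprn_gt0.
have HF i t : 0 <= t <= T ->
    `|free_path lam r g v i t - free_path lam r G V i t|
      <= (3 * T + 1) * eta' * 2 ^+ i.
  move=> /[dup] tT /andP[t0 t1]; rewrite /free_path.
  have : `|\int[mu]_(s in `[0, t]) (G s i - G s i.+1)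
      - \int[mu]_(s in `[0, t]) (g s i - g s i.+1)| <= 3 * eta' * 2 ^+ i * t.
    rewrite -RintegralB//; [|exact: outflow_integrable t1..].
    apply: norm_Rintegral_le => //.
      by apply: measurable_funB; apply: measurable_funB; apply: measurable_itv0 t1 _.
    move=> s /andP[s0 st]; have sT : 0 <= s <= T by rewrite s0 (le_trans st).
    have := Gg i s sT; have := Gg i.+1 s sT; rewrite exprS !ler_norml; lra.
  have : `|v_pred lam V i t - v_pred lam v i t| <= eta' * 2 ^+ i.
    case: i => [|i] /=; first by rewrite subrr normr0 mulr_ge0// ltW.
    apply: le_trans (Vv i t tT) _; rewrite ler_wpM2l// exprS.
    by have := p0 i; lra.
  have : 3 * eta' * 2 ^+ i * t <= 3 * eta' * 2 ^+ i * T.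
    by rewrite ler_wpM2l// !mulr_ge0// ltW.
  rewrite !ler_norml; lra.
split => // i.
- have [M VMi] := VM i; exists (M + eta' * 2 ^+ i) => t tT.
  by have := VMi t tT; have := Vv i t tT; rewrite !ler_norml; lra.
- move=> t tT; have := HF i t tT; have := HG i t tT; have := Gg i t tT.
  have := Vv i t tT; rewrite !ler_norml; lra.
- move=> t /[dup] tT /andP[t0 t1].
  have [M vM] := v_pred_bounded lam T0 VM i.
  have sub s : 0 <= s <= t -> 0 <= s <= T.
    by move=> /andP[-> /le_trans]; apply.
  have : `|Gamma_hat 1 (free_path lam r g v i) t - Gamma_hat 1 (free_path lam r G V i) t|
      <= (3 * T + 1) * eta' * 2 ^+ i.
    apply: (@Gamma_hat_lipschitz _ 1 _ _ _ _ (`|r i| + T + M)) => // s /sub sT.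
      exact: free_path_le (vM _ sT).
    exact: HF.
  have := HV i t tT; have := Vv i t tT.
  have : 0 <= eta' * 2 ^+ i by rewrite mulr_ge0// ltW.
  rewrite !ler_norml; lra.
Qed.

Lemma continuous_path_coord_measurable g T i :
  continuous_path l1_down (lp_dist 1%E) g -> measurable_fun `[0, T] (g ^~ i).
Proof.
move=> cg; apply: right_continuous_measurable => s s0.
apply: (@coord_cvg _ _ s^'+) => A /(cg s s0).2.
move=> nA.
have {}nA : \forall x \near s, 0 <= x -> A (lp_dist 1%E (g x) (g s)) := nA.
suff : \forall x \near s, s < x -> A (lp_dist 1%E (g x) (g s)) by [].
by apply: filterS nA => x Ax sx; apply: Ax; rewrite (le_trans s0)// ltW.
Qed.

(** Only the boundedness of each [v] coordinate needs an argument: it passes from one coordinate to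
    the next through the regulator, starting from the input [lam * t]. *)
Lemma fluid_approx_solution lam r T g v : 0 <= T -> fluid_solution lam r g v ->
  approx_solution lam r T 0 g v.
Proof.
move=> T0 [cg cv gv].
have mg i : measurable_fun `[0, T] (g ^~ i) by exact: continuous_path_coord_measurable.
have g01 i t : 0 <= t <= T -> 0 <= g t i <= 1.
  by move=> /andP[t0 _]; have [[_ _ H] _] := cg t t0; exact: H.
have vM i : exists M : R, forall t, 0 <= t <= T -> `|v t i| <= M.
  have sub t s : t <= T -> 0 <= s <= t -> 0 <= s <= T.
    by move=> tT /andP[-> /le_trans]; apply.
  have step j (M : R) : (forall t, 0 <= t <= T -> `|v_pred lam v j t| <= M) ->
      exists M : R, forall t, 0 <= t <= T -> `|v t j| <= M.
    move=> HM; exists (`|r j| + T + M) => t /andP[t0 tT].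
    have FM s : 0 <= s <= t -> free_path lam r g v j s <= `|r j| + T + M.
      by move=> /(sub _ _ tT) sT; exact: free_path_le (HM _ sT).
    have M0 : 0 <= M by apply: le_trans (HM 0 _); rewrite ?lexx.
    rewrite (gv j t t0).2 ger0_norm; last exact: Gamma_hat_ge0 FM.
    apply: Gamma_hat_le => //; first by rewrite !addr_ge0.
    by move=> s /FM; lra.
  elim: i => [|i [M IH]]; last exact: (step _ M).
  apply: (step 0%N (`|lam| * T)) => t /andP[t0 tT] /=.
  by rewrite normrM (ger0_norm t0) ler_wpM2l.
split => // i t /andP[t0 _]; have [gE vE] := gv i t t0.
- by rewrite gE /Gamma -vE subrr normr0 mul0r.
- by rewrite -vE subrr normr0 mul0r.
Qed.

Lemma approx_solution_exact lam r g v :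
  (forall T, 0 <= T -> forall e : R, 0 < e -> approx_solution lam r T e g v) ->
  forall i t, 0 <= t ->
    g t i = Gamma 1 (free_path lam r g v i) t /\
    v t i = Gamma_hat 1 (free_path lam r g v i) t.
Proof.
move=> H i t t0.
have small (x : R) : (forall e, 0 < e -> `|x| <= e * 2 ^+ i) -> x = 0.
  move=> Hx; apply/eqP; rewrite -normr_le0; apply/ler_addgt0Pr => e e0.
  rewrite add0r; have p0 : 0 < 2 ^+ i :> R by rewrite exprn_gt0.
  by have := Hx (e / 2 ^+ i); rewrite divr_gt0// divfK ?gt_eqF//; apply.
have tt : 0 <= t <= t by rewrite t0 lexx.
have vE : v t i = Gamma_hat 1 (free_path lam r g v i) t.
  by apply/eqP; rewrite -subr_eq0; apply/eqP/small => e /(H t t0)[_ _ _ _]; apply.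
split => //; rewrite /Gamma -vE.
by apply/eqP; rewrite -subr_eq0; apply/eqP/small => e /(H t t0)[_ _ _ + _]; apply.
Qed.

Lemma fluid_solution_unique lam r g v g' v' :
  fluid_solution lam r g v -> fluid_solution lam r g' v' ->
  forall t, 0 <= t -> g' t = g t /\ v' t = v t.
Proof.
move=> gv gv' t t0.
have H := stability t0 (fluid_approx_solution t0 gv') (fluid_approx_solution t0 gv).
have tt : 0 <= t <= t by rewrite t0 lexx.
split; apply/funext => i; have [] := H i t tt;
  rewrite addr0 mulr0 mul0r !normr_le0 !subr_eq0 => /eqP + /eqP; done.
Qed.

End ApproximateSolutions.

(** * The routing function [beta] *)

Section RoutingFunction.
Context {R : realType}.
Implicit Types (n d : nat) (x y : R).

(** With [a = i / n < 1], the inequality [(x - a) / (1 - a) <= x] amounts to [a * x <= a]. Taken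
    factor by factor it gives [beta n d x <= x ^+ d]. *)
Lemma beta_factor_bounds n d (i : 'I_d) x : (d <= n)%N -> 0 <= x <= 1 ->
  0 <= Num.max ((x - i%:R / n%:R) / (1 - i%:R / n%:R)) 0 <= x.
Proof.
move=> dn /andP[x0 x1]; have n0 : (0 : R) < n%:R.
  by rewrite ltr0n (leq_trans _ dn)// (leq_ltn_trans _ (ltn_ord i)).
have a1 : i%:R / n%:R < 1 :> R.
  by rewrite ltr_pdivrMr// mul1r ltr_nat (leq_trans _ dn).
have a0 : 0 <= i%:R / n%:R :> R by rewrite divr_ge0.
rewrite le_max lexx orbT /= ge_max x0 andbT ler_pdivrMr ?subr_gt0//.
set a := i%:R / n%:R in a0 a1 *.
have : a * x <= a by rewrite ler_piMr.
lra.
Qed.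

Lemma beta_ge0 n d x : (d <= n)%N -> 0 <= x <= 1 -> 0 <= beta n d x.
Proof.
by move=> dn x01; apply: prodr_ge0 => i _; case/andP: (beta_factor_bounds i dn x01).
Qed.

Lemma beta_le_expr n d x : (d <= n)%N -> 0 <= x <= 1 -> beta n d x <= x ^+ d.
Proof.
move=> dn x01; rewrite -[d in leRHS]card_ord -prodr_const.
by apply: ler_prod => i _; exact: beta_factor_bounds.
Qed.

Lemma beta_le1 n d x : (d <= n)%N -> 0 <= x <= 1 -> beta n d x <= 1.
Proof.
move=> dn x01; apply: le_trans (beta_le_expr dn x01) _.
by case/andP: x01 => x0 x1; rewrite exprn_ile1.
Qed.

Lemma beta_1 n d : (d <= n)%N -> beta n d 1 = 1 :> R.
Proof.
move=> dn; rewrite /beta big1// => i _.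
have n0 : (0 : R) < n%:R.
  by rewrite ltr0n (leq_trans _ dn)// (leq_ltn_trans _ (ltn_ord i)).
rewrite divff ?max_l// subr_eq0 eq_sym lt_eqF//.
by rewrite ltr_pdivrMr// mul1r ltr_nat (leq_trans _ dn).
Qed.

Lemma beta_homo n d x y : (d <= n)%N -> 0 <= x -> x <= y -> y <= 1 ->
  beta n d x <= beta n d y.
Proof.
move=> dn x0 xy y1; apply: ler_prod => i _.
have n0 : (0 : R) < n%:R.
  by rewrite ltr0n (leq_trans _ dn)// (leq_ltn_trans _ (ltn_ord i)).
have a1 : i%:R / n%:R < 1 :> R.
  by rewrite ltr_pdivrMr// mul1r ltr_nat (leq_trans _ dn).
rewrite le_max lexx orbT /= ge_max !le_max lexx orbT andbT.
by rewrite ler_pM2r ?invr_gt0 ?subr_gt0// lerD2r xy.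
Qed.

Lemma measurable_beta n d (D : set R) (f : R -> R) :
  measurable D -> measurable_fun D f -> measurable_fun D (fun s => beta n d (f s)).
Proof.
move=> mD mf; rewrite /beta; under eq_fun do rewrite -big_enum /=.
elim: (enum _) => [|i s IH].
  by under eq_fun do rewrite big_nil; exact: measurable_cst.
under eq_fun do rewrite big_cons.
apply: measurable_funM => //; apply: measurable_maxr => //.
by apply: measurable_funM => //; apply: measurable_funB.
Qed.

End RoutingFunction.

(** * Deterministic estimates for one sample path of the queues *)

Section QueuePaths.
Context {R : realType}.
Local Notation mu := (@lebesgue_measure R).
Implicit Types (n d m : nat) (lamn t s T : R) (G : R -> nat -> R)
  (Nm Np : nat -> R -> nat).

(** The almost sure event of [jsq_process], read at one sample point, so that the estimates of this
    part involve no probability. *)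
Definition jsq_path n d lamn Nm Np G : Prop :=
  [/\ forall i, exists k : nat, G 0 i = k%:R / n%:R,
      cadlag_path l1_down (lp_dist 1%E) G
    & jsq_equation n d lamn Nm Np G].

(* The fluid counterpart of [overflow n d lamn G t i] is [v t i]. *)
Definition overflow n d lamn G t i : R :=
  lamn * \int[mu]_(s in `[0, t]) beta n d (G s i).

Section path_facts.
Context (n d : nat) (lamn : R) (Nm Np : nat -> R -> nat) (G : R -> nat -> R).
Context (n_gt0 : (0 < n)%N) (d_le : (d <= n)%N) (lamn_ge0 : 0 <= lamn)
  (G_path : jsq_path n d lamn Nm Np G).
Local Notation V := (overflow n d lamn G).

Lemma path_bounds i t : 0 <= t -> 0 <= G t i <= 1.
Proof. by move=> t0; case: G_path => _ [H _ _] _; case: (H t t0) => _ _; exact. Qed.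

Lemma path_antitone i j t : 0 <= t -> (i <= j)%N -> G t j <= G t i.
Proof.
move=> t0; case: G_path => _ [H _ _] _; case: (H t t0) => _ GS _.
by apply: (@homo_leq _ _ (fun x y => y <= x)) => // y x z xy yz; exact: le_trans yz xy.
Qed.

Lemma path_measurable T i : measurable_fun `[0, T] (G ^~ i).
Proof.
apply: right_continuous_measurable => s s0.
by case: G_path => _ [_ H _] _; apply: coord_cvg; exact: H.
Qed.

Lemma beta_path_bounds i t : 0 <= t -> 0 <= beta n d (G t i) <= 1.
Proof. by move=> /(path_bounds i) H; rewrite beta_ge0// beta_le1. Qed.

Lemma measurable_beta_path T i : measurable_fun `[0, T] (fun s => beta n d (G s i)).
Proof. by apply: measurable_beta => //; exact: path_measurable. Qed.

Lemma overflow0 i : V 0 i = 0.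
Proof. by rewrite /overflow set_itv1 Rintegral_set1 mulr0. Qed.

Lemma overflow_increment s t i (b : R) : 0 <= s -> s <= t ->
  (forall u, s < u <= t -> beta n d (G u i) <= b) ->
  0 <= V t i - V s i <= lamn * b * (t - s).
Proof.
move=> s0 st Hb; rewrite /overflow -mulrBr.
have := @Rintegral_increment_bounds _ s t 0 b (fun u => beta n d (G u i)) 1 s0 st
  (@measurable_beta_path t i).
have H1 u : 0 <= u <= t -> `|beta n d (G u i)| <= 1.
  by move=> /andP[u0 _]; have /andP[? ?] := beta_path_bounds i u0; rewrite ger0_norm.
have H2 u : s < u <= t -> 0 <= beta n d (G u i) <= b.
  move=> /[dup] sut /Hb ->; case/andP: sut => su _.
  by have /andP[-> _] := beta_path_bounds i (le_trans s0 (ltW su)).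
move=> /(_ H1 H2); rewrite mul0r => /andP[h1 h2].
by rewrite mulr_ge0//= -mulrA ler_wpM2l.
Qed.

Lemma overflow_lipschitz s t i : 0 <= s -> s <= t ->
  0 <= V t i - V s i <= lamn * (t - s).
Proof.
move=> s0 st; have := @overflow_increment s t i 1 s0 st.
rewrite mulr1; apply => u /andP[su _].
by case/andP: (beta_path_bounds i (le_trans s0 (ltW su))).
Qed.

Lemma overflow_bounds t i : 0 <= t -> 0 <= V t i <= lamn * t.
Proof. by move=> t0; have := overflow_lipschitz i (lexx 0) t0; rewrite overflow0 !subr0. Qed.

Lemma overflow_antitone t i : 0 <= t -> V t i.+1 <= V t i.
Proof.
move=> t0; rewrite /overflow ler_wpM2l//; apply: le_Rintegral => //.
- apply: (integrable_itv0 (c := 1)); first exact: measurable_beta_path.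
  by move=> s /andP[s0 _]; have /andP[? ?] := beta_path_bounds i.+1 s0; rewrite ger0_norm.
- apply: (integrable_itv0 (c := 1)); first exact: measurable_beta_path.
  by move=> s /andP[s0 _]; have /andP[? ?] := beta_path_bounds i s0; rewrite ger0_norm.
- move=> s; rewrite /= in_itv /= => /andP[s0 _].
  have /andP[h1 _] := path_bounds i.+1 s0; have /andP[_ h2] := path_bounds i s0.
  by apply: beta_homo => //; exact: path_antitone.
Qed.

Lemma inflow_ge0 t i : 0 <= t -> 0 <= v_pred lamn V i t - V t i.
Proof.
move=> t0; rewrite subr_ge0; case: i => [|i] /=; last exact: overflow_antitone.
by case/andP: (overflow_bounds 0 t0).
Qed.

(** In terms of [V] the arrival clock of coordinate [i] is the difference of two consecutive
    overflows. At [i = 0] the identity [beta n d 1 = 1] makes the missing overflow the external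
    input [lamn * t]. *)
Lemma path_equation i t : 0 <= t ->
  G t i = G 0 i - n%:R^-1 * (Nm i (n%:R * \int[mu]_(s in `[0, t]) (G s i - G s i.+1)))%:R
    + n%:R^-1 * (Np i (n%:R * (v_pred lamn V i t - V t i)))%:R.
Proof.
move=> t0; case: G_path => _ _ /(_ i t t0) ->.
congr (_ - _ + _ * (Np i _)%:R).
have bi j : mu.-integrable `[0, t] (EFin \o (fun s => beta n d (G s j))).
  apply: (integrable_itv0 (c := 1)); first exact: measurable_beta_path.
  by move=> s /andP[s0 _]; have /andP[? ?] := beta_path_bounds j s0; rewrite ger0_norm.
rewrite [lamn * _]mulrC -mulrA; congr (_ * _).
case: i => [|i] /=; last by rewrite RintegralB// mulrBr.
have -> : \int[mu]_(s in `[0, t]) (beta n d 1 - beta n d (G s 0%N)) =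
    \int[mu]_(s in `[0, t]) (1 - beta n d (G s 0%N)).
  by apply: eq_Rintegral => s _; rewrite beta_1.
rewrite RintegralB//; last exact: (integrable_itv0 (c := `|1|)).
by rewrite Rintegral_cst//= itv0_measureE// mul1r mulrBr.
Qed.

(** While [G <= 1 - e], the rate of [V] is at most [Lam * (1 - e) ^+ d], so its increments there
    stay below [e] on all of [[0, T]], as [Gamma_hat_approx] requires. *)
Lemma overflow_regulator T i t (e Lam : R) : 0 <= t <= T -> 0 < e < 1 ->
  lamn <= Lam -> Lam * T * (1 - e) ^+ d <= e ->
  `|V t i - Gamma_hat 1 (fun s => G s i + V s i) t| <= 2 * e.
Proof.
move=> /andP[t0 tT] /andP[e0 e1] lL Le.
apply: (@Gamma_hat_approx _ (G ^~ i) (V ^~ i) e lamn) => //.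
- exact: overflow0.
- by move=> s u s0 su _; exact: overflow_lipschitz.
- by move=> s /andP[s0 _]; case/andP: (path_bounds i s0).
move=> s u s0 su ut Ge.
have /andP[_ /le_trans] : 0 <= V u i - V s i <= lamn * (1 - e) ^+ d * (u - s).
  apply: overflow_increment => //.
  move=> x /[dup] sux /andP[sx _]; have Gx := path_bounds i (le_trans s0 (ltW sx)).
  apply: le_trans (beta_le_expr d_le Gx) _; case/andP: Gx => Gx0 _.
  by apply: lerXn2r; rewrite ?nnegrE ?Ge// subr_ge0 ltW.
apply; apply: le_trans Le; rewrite mulrAC ler_wpM2r ?exprn_ge0 ?subr_ge0 ?(ltW e1)//.
apply: ler_pM => //; first by rewrite subr_ge0.
by rewrite lerBlDr (le_trans ut)// (le_trans tT)// lerDl.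
Qed.

(** For [i < m] there are four errors of size [delta]: the initial value, the two Poisson processes,
    and [lamn] against [lam]. For [i >= m] the crude bound [2 + T + Lam * T] is already below
    [eta * 2 ^+ i]. [U] bounds both Poisson clocks divided by [n]. *)
Lemma jsq_path_approx lam r T (Lam U delta e eta : R) m :
  0 <= T -> 0 < e < 1 -> 0 <= eta ->
  (forall i, 0 <= r i <= 1) ->
  lamn <= Lam -> Lam * T * (1 - e) ^+ d <= e ->
  `|lamn - lam| * T <= delta -> T <= U -> Lam * T <= U ->
  (forall i, `|G 0 i - r i| <= delta) ->
  (forall i u, (i < m)%N -> 0 <= u <= U ->
     `|n%:R^-1 * (Nm i (n%:R * u))%:R - u| <= delta /\
     `|n%:R^-1 * (Np i (n%:R * u))%:R - u| <= delta) ->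
  4 * delta <= eta -> delta <= 1 -> 2 + T + Lam * T <= eta * 2 ^+ m ->
  approx_solution lam r T (eta + 2 * e) G V.
Proof.
move=> T0 e01 eta0 r01 lL Le ll TU LU Gr HN deta delta1 metra.
have mG i := @path_measurable T i.
have G01 i t : 0 <= t <= T -> 0 <= G t i <= 1.
  by move=> /andP[t0 _]; exact: path_bounds.
have delta0 : 0 <= delta by apply: le_trans (Gr 0%N).
have p1 i : 1 <= 2 ^+ i :> R by rewrite exprn_ege1// ler1n.
have lamT t : 0 <= t <= T -> 0 <= lamn * t <= Lam * T.
  by move=> /andP[t0 tT]; rewrite mulr_ge0//= ler_pM.
have VT i t : 0 <= t <= T -> 0 <= V t i <= Lam * T.
  move=> /[dup] tT /andP[t0 _]; have /andP[-> /le_trans] := overflow_bounds i t0.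
  by apply; case/andP: (lamT t tT).
have vpT i t : 0 <= t <= T -> 0 <= v_pred lamn V i t <= Lam * T.
  by case: i => [|i] /= tT; [exact: lamT|exact: VT].
have vpE i t : 0 <= t <= T -> `|v_pred lamn V i t - v_pred lam V i t| <= delta.
  case: i => [|i] /= /andP[t0 tT]; last by rewrite subrr normr0.
  rewrite -mulrBl normrM (ger0_norm t0); apply: le_trans ll.
  by rewrite ler_wpM2l.
have fp i t : 0 <= t <= T -> `|G t i - (free_path lam r G V i t - V t i)| <= eta * 2 ^+ i.
  move=> /[dup] tT /andP[t0 t1].
  pose J := \int[mu]_(s in `[0, t]) (G s i - G s i.+1).
  have J0T : 0 <= J <= T.
    rewrite Rintegral_ge0/=; last first.
      by move=> s /=; rewrite in_itv /= subr_ge0 => /andP[s0 _]; exact: path_antitone.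
    apply: le_trans t1; apply: le_trans (outflow_le i mG G01 tT).
    exact: ler_norm.
  have inn : 0 <= v_pred lamn V i t - V t i <= Lam * T.
    rewrite inflow_ge0//=.
    have h1 := VT i t tT; have h2 := vpT i t tT; lra.
  have := vpE i t tT; rewrite /free_path -/J; have [im|mi] := ltnP i m.
    have JU : 0 <= J <= U by lra.
    have iU : 0 <= v_pred lamn V i t - V t i <= U by lra.
    have := path_equation i t0; rewrite -/J.
    have [h1 _] := HN i _ im JU; have [_ h2] := HN i _ im iU.
    have h3 := Gr i.
    have : eta <= eta * 2 ^+ i by rewrite ler_peMr.
    move: h1 h2 h3; set x := _ * _%:R; set y := _ * _%:R; rewrite !ler_norml.
    lra.
  have := G01 i t tT; have := r01 i.
  have : eta * 2 ^+ m <= eta * 2 ^+ i by rewrite ler_wpM2l// ler_eXn2l// ltr1n.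
  rewrite !ler_norml; lra.
split => //.
- by move=> i; exists (Lam * T) => t /(VT i) /andP[V0 VL]; rewrite ger0_norm.
- move=> i t tT; apply: le_trans (fp i t tT) _.
  rewrite ler_wpM2r ?exprn_ge0// lerDl mulr_ge0//; lra.
- move=> i t /[dup] tT /andP[t0 t1].
  have h1 := overflow_regulator i tT e01 lL Le.
  have [M vM] : exists M : R, forall t, 0 <= t <= T -> `|v_pred lam V i t| <= M.
    by exists (Lam * T + delta) => u uT; have := vpE i u uT; have := vpT i u uT;
      rewrite !ler_norml; lra.
  have sub s : 0 <= s <= t -> 0 <= s <= T.
    by move=> /andP[-> /le_trans]; apply.
  have h2 : `|Gamma_hat 1 (fun s => G s i + V s i) t
      - Gamma_hat 1 (free_path lam r G V i) t| <= eta * 2 ^+ i.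
    apply: (@Gamma_hat_lipschitz _ 1 _ _ _ _ (`|r i| + T + M)) => // s /sub sT.
      exact: free_path_le (vM _ sT).
    by have := fp i s sT; rewrite !ler_norml; lra.
  move: h1 h2; have : 2 * e <= 2 * e * 2 ^+ i by rewrite ler_peMr//; lra.
  rewrite !ler_norml; lra.
Qed.

Lemma jsq_path_coord_le (A : R) (z : nat -> R) m i t : 0 <= t ->
  (forall i, 0 <= z i) ->
  (forall i u, (i < m)%N -> 0 <= u -> (Np i u)%:R <= A * u + z i) ->
  (i < m)%N ->
  G t i <= G 0 i + A * (v_pred lamn V i t - V t i) + n%:R^-1 * z i.
Proof.
move=> t0 z0 HN im; rewrite (path_equation i t0).
have n0 : 0 < n%:R^-1 :> R by rewrite invr_gt0 ltr0n.
have u0 : 0 <= n%:R * (v_pred lamn V i t - V t i) by rewrite mulr_ge0// inflow_ge0.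
have := HN i _ im u0; rewrite -(ler_pM2l n0).
have -> : n%:R^-1 * (A * (n%:R * (v_pred lamn V i t - V t i)) + z i) =
    A * (v_pred lamn V i t - V t i) + n%:R^-1 * z i.
  by rewrite mulrDr; congr (_ + _); rewrite mulrCA mulKf// pnatr_eq0 -lt0n.
have : 0 <= n%:R^-1 * (Nm i (n%:R * \int[mu]_(s in `[0, t]) (G s i - G s i.+1)))%:R :> R.
  by rewrite mulr_ge0// ltW.
set a := n%:R^-1 * _; set b := n%:R^-1 * _; lra.
Qed.

(** [n * G 0 i] is an integer, so a positive count of initial and arrived jobs is at least 1. *)
Lemma jsq_path_coord_pos i t : 0 <= t -> 0 < G t i ->
  1 <= n%:R * G 0 i + (Np i (n%:R * (v_pred lamn V i t - V t i)))%:R.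
Proof.
move=> t0; rewrite (path_equation i t0).
case: G_path => /(_ i)[k ->] _ _.
have n0 : 0 < n%:R :> R by rewrite ltr0n.
rewrite -(ltr_pM2l n0) mulr0 mulrDr mulrBr !mulrA mulfV ?gt_eqF// !mul1r.
set a := Nm _ _; set b := Np _ _.
have -> : n%:R * k%:R / n%:R = k%:R :> R by rewrite mulrAC mulfV ?gt_eqF ?mul1r.
rewrite -natrD ler1n => H; rewrite lt0n; apply/eqP => kb; move: H.
have := ler0n R a; have : (k + b)%:R = 0 :> R by rewrite kb.
by rewrite natrD; lra.
Qed.

Lemma sum_inflow K M t : (K <= M)%N ->
  \sum_(K <= i < M) (v_pred lamn V i t - V t i) = v_pred lamn V K t - v_pred lamn V M t.
Proof.
move=> KM; rewrite -[RHS]opprB -(telescope_sumr (v_pred lamn V ^~ t) KM) -sumrN.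
by apply: eq_bigr => i _; rewrite opprB.
Qed.

Lemma v_pred_ge0 i t : 0 <= t -> 0 <= v_pred lamn V i t <= lamn * t.
Proof.
case: i => [|i] t0 /=; first by rewrite mulr_ge0 ?lexx.
exact: overflow_bounds.
Qed.

(* Each of the first [m] nonempty levels either was nonempty initially or has
   received a job, so [m] is bounded by the number of jobs that ever entered. *)
Lemma jsq_path_empty_level (S A x : R) (z : nat -> R) m t : 0 <= t -> 0 <= A ->
  (forall M, \sum_(0 <= i < M) G 0 i <= S) ->
  (forall i, 0 <= z i) -> (forall M, \sum_(0 <= i < M) z i <= n%:R * x) ->
  (forall i u, (i < m)%N -> 0 <= u -> (Np i u)%:R <= A * u + z i) ->
  n%:R * (S + A * (lamn * t) + x) < m%:R ->
  forall i, (m <= i.+1)%N -> G t i = 0.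
Proof.
move=> t0 A0 GS z0 zx HN Sm.
have n0 : 0 < n%:R :> R by rewrite ltr0n.
case: m => [|m] in Sm HN *.
  have : 0 <= n%:R * (S + A * (lamn * t) + x).
    rewrite mulr_ge0// !addr_ge0// ?mulr_ge0//.
      by have := GS 0%N; rewrite big_geq.
    by have := zx 0%N; rewrite big_geq// pmulr_rge0.
  by rewrite leNgt Sm.
(* The bound is now called [m.+1]. If coordinate [m] were positive, so would be the [m.+1]
   coordinates up to it, and each contributes at least 1 to a sum that is too small for that. *)
suff Gm : G t m = 0.
  move=> i mi; apply/eqP; rewrite eq_le; have /andP[-> _] := path_bounds i t0.
  by rewrite -Gm path_antitone.
apply/eqP; rewrite eq_le; have /andP[-> _] := path_bounds m t0; rewrite andbT.
rewrite leNgt; apply/negP => Gm; move: Sm; apply/negP; rewrite -leNgt.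
apply: (@le_trans _ _ (\sum_(0 <= i < m.+1) (n%:R * G 0 i
   + (A * (n%:R * (v_pred lamn V i t - V t i)) + z i)))).
  rewrite -[leLHS]mulr1 mulr_natl -[X in _ *+ X](subn0 m.+1) -sumr_const_nat.
  rewrite big_nat [leRHS]big_nat; apply: ler_sum => i /= im.
  have Gi : 0 < G t i by rewrite (lt_le_trans Gm)// path_antitone.
  apply: le_trans (jsq_path_coord_pos t0 Gi) _; rewrite lerD2l.
  by apply: HN => //; rewrite mulr_ge0// inflow_ge0.
(* The inflows telescope, so all levels together receive at most the external input [lamn * t]. *)
rewrite !big_split /= -!mulr_sumr sum_inflow// addrA [leRHS]mulrDr [X in _ <= X + _]mulrDr.
rewrite lerD// lerD ?ler_pM2l//.
rewrite [leLHS]mulrCA ler_pM2l// ler_wpM2l//=.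
by rewrite gerBl; case/andP: (v_pred_ge0 m.+1 t0).
Qed.

(** Inflows into the coordinates from [K] on telescope to at most [v_pred lamn V K t]: a job reaches
    them only by overflowing the coordinate before [K]. The linear bounds cover [i < m], and the
    remaining coordinates vanish. *)
Lemma jsq_path_sum_le (A x : R) (z : nat -> R) m K M t : 0 <= t -> 0 <= A ->
  (forall i, 0 <= z i) -> (forall M, \sum_(0 <= i < M) z i <= n%:R * x) ->
  (forall i u, (i < m)%N -> 0 <= u -> (Np i u)%:R <= A * u + z i) ->
  (forall i, (m <= i)%N -> G t i = 0) ->
  \sum_(K <= i < M) G t i
    <= \sum_(K <= i < M) G 0 i + A * v_pred lamn V K t + x.
Proof.
move=> t0 A0 z0 zx HN Gm.
have n0 : 0 < n%:R :> R by rewrite ltr0n.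
have x0 : 0 <= x by have := zx 0%N; rewrite big_geq// pmulr_rge0.
have /andP[vK0 _] := v_pred_ge0 K t0.
have [KM|MK] := leqP K M; last first.
  by rewrite !big_geq ?(ltnW MK)// add0r addr_ge0// mulr_ge0.
apply: (@le_trans _ _ (\sum_(K <= i < M) (G 0 i +
    A * (v_pred lamn V i t - V t i) + n%:R^-1 * z i))).
  apply: ler_sum => i _; have [im|mi] := ltnP i m.
    exact: (jsq_path_coord_le t0 z0 HN im).
  have /andP[g0 _] := path_bounds i (lexx 0).
  by rewrite Gm// !addr_ge0// mulr_ge0 ?inflow_ge0// invr_ge0 ltW.
rewrite !big_split /= -!mulr_sumr sum_inflow// lerD// ?lerD2l.
  rewrite ler_wpM2l//; have := v_pred_ge0 M t0; lra.
rewrite ler_pdivrMl//; apply: le_trans (zx M).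
by rewrite [leRHS](@big_cat_nat _ _ _ K)//= lerDr sumr_ge0.
Qed.

(* The constants [A1] and [x1] bound the total mass by [C], which forces
   [G t K <= 1 / 2]; the finer pair [A2], [x2] then bounds the mass above [K]. *)
Lemma jsq_path_tail T (S A1 x1 A2 x2 C Lam : R) (z1 z2 : nat -> R) m :
  0 <= T -> 0 <= A1 -> 0 <= A2 -> lamn <= Lam ->
  (forall M, \sum_(0 <= i < M) G 0 i <= S) ->
  (forall i, 0 <= z1 i) -> (forall M, \sum_(0 <= i < M) z1 i <= n%:R * x1) ->
  (forall i u, (i < m)%N -> 0 <= u -> (Np i u)%:R <= A1 * u + z1 i) ->
  (forall i, 0 <= z2 i) -> (forall M, \sum_(0 <= i < M) z2 i <= n%:R * x2) ->
  (forall i u, (i < m)%N -> 0 <= u -> (Np i u)%:R <= A2 * u + z2 i) ->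
  S + A1 * (Lam * T) + x1 <= C -> n%:R * C < m%:R ->
  forall K M t, 2 * C <= K.+1%:R -> 0 <= t <= T ->
  \sum_(K.+1 <= i < M) G t i <=
    \sum_(K.+1 <= i < M) G 0 i + A2 * (Lam * T * 2^-1 ^+ d) + x2.
Proof.
move=> T0 A10 A20 lL GS z10 z1x HN1 z20 z2x HN2 SC Cm K M t CK /andP[t0 tT].
have n0 : 0 < n%:R :> R by rewrite ltr0n.
have Lam0 : 0 <= Lam by exact: le_trans lL.
have lLT s : 0 <= s <= t -> lamn * s <= Lam * T.
  by move=> /andP[s0 st]; apply: ler_pM => //; exact: le_trans tT.
have Sm s : 0 <= s <= t -> n%:R * (S + A1 * (lamn * s) + x1) < m%:R.
  move=> st; apply: le_lt_trans Cm; rewrite ler_pM2l//; apply: le_trans SC.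
  by rewrite lerD2r lerD2l ler_wpM2l// lLT.
have empty s : 0 <= s <= t -> forall i, (m <= i)%N -> G s i = 0.
  move=> /[dup] st /andP[s0 _] i mi.
  by apply: (jsq_path_empty_level s0 A10 GS z10 z1x HN1 (Sm s st)); exact: leqW.
have half s : 0 <= s <= t -> G s K <= 2^-1.
  move=> /[dup] st /andP[s0 _].
  have := jsq_path_sum_le 0 K.+1 s0 A10 z10 z1x HN1 (empty s st).
  (* Coordinates decrease, so [K.+1] copies of [G s K] fit into a total mass of at most [C]; then
     [2 * C <= K.+1] yields [1 / 2]. *)
  have sumK : K.+1%:R * G s K <= \sum_(0 <= i < K.+1) G s i.
    rewrite mulr_natl -[X in _ *+ X](subn0 K.+1) -sumr_const_nat.
    by rewrite big_nat [leRHS]big_nat; apply: ler_sum => i /= iK; exact: path_antitone.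
  move=> /(le_trans sumK) /= H.
  have {}H : K.+1%:R * G s K <= C.
    apply: le_trans H _; apply: le_trans SC; rewrite lerD2r lerD//.
    by rewrite ler_wpM2l// lLT.
  rewrite -(@ler_pM2l _ K.+1%:R)// ler_pdivlMr//; lra.
have tt : 0 <= t <= t by rewrite t0 lexx.
apply: le_trans (jsq_path_sum_le K.+1 M t0 A20 z20 z2x HN2 (empty t tt)) _.
rewrite lerD2r lerD2l ler_wpM2l//=.
have := @overflow_increment 0 t K (2^-1 ^+ d) (lexx 0) t0.
rewrite overflow0 !subr0 => /(_ _)/andP[u /andP[u0 ut]|_ /le_trans]; last first.
  apply; rewrite mulrAC ler_wpM2r ?exprn_ge0 ?invr_ge0//.
  exact: lLT.
have GK := path_bounds K (ltW u0).
apply: le_trans (beta_le_expr d_le GK) _; case/andP: GK => GK0 _.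
by apply: lerXn2r; rewrite ?nnegrE ?half ?invr_ge0// (ltW u0).
Qed.

End path_facts.
End QueuePaths.

(** * Union bounds for outer probabilities *)

Section OuterProbability.
Context {R : realType} {disp : measure_display} {T : measurableType disp}
  (P : probability T R).
Implicit Types A B : set T.

Lemma outer_le_measure A B : measurable B -> A `<=` B -> (P^*%mu A <= P B)%E.
Proof. by move=> mB AB; rewrite -(measurable_mu_extE P mB); exact: le_outer_measure. Qed.

Lemma outer_negligible A : P.-negligible A -> P^*%mu A = 0%E.
Proof.
move=> [B [mB PB AB]]; apply/eqP; rewrite eq_le outer_measure_ge0 andbT -PB.
exact: outer_le_measure.
Qed.

Lemma outer_leU A B (a b : R) : (P^*%mu A <= a%:E)%E -> (P^*%mu B <= b%:E)%E ->
  (P^*%mu (A `|` B) <= (a + b)%:E)%E.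
Proof.
by move=> Aa Bb; apply: le_trans (outer_measureU2 _ _ _) _; rewrite EFinD leeD.
Qed.

Lemma outer_le_bigsetU (F : (set T)^nat) m (b : R) :
  (forall i, (i < m)%N -> (P^*%mu (F i) <= b%:E)%E) ->
  (P^*%mu (\big[setU/set0]_(i < m) F i) <= (m%:R * b)%:E)%E.
Proof.
move=> Fb; apply: le_trans (outer_measure_subadditive _ _ _) _.
apply: (@le_trans _ _ (\sum_(i < m) b%:E)%E).
  by apply: lee_sum => i _; exact: Fb.
by rewrite sumEFin lee_fin sumr_const card_ord mulr_natl.
Qed.

(** The bridge from probability to deterministic statements: a bad event of outer probability below
    1 leaves a good sample path to work with. *)
Lemma outer_lt1_not_full A (q : R) : q < 1 -> (P^*%mu A <= q%:E)%E -> exists w, ~ A w.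
Proof.
move=> q1 Aq; apply/existsNP => HA; move: Aq.
have -> : A = setT by apply/seteqP; split => // w _; exact: HA.
by rewrite measurable_mu_extE//= probability_setT lee_fin leNgt q1.
Qed.

End OuterProbability.

(** * Poisson processes: law of large numbers and linear growth bounds *)

(** [x] solves [U * (x / (1 - x)) = eps / 2]. The second order term of either tail is then at most
    [x * (eps / 2)], half of the linear gain [x * eps]. *)
Lemma chernoff_exponents {R : realType} (u eps U : R) :
  0 < eps -> 0 < u -> u <= U -> let x := eps / (2 * U + eps) in
  [/\ 0 < x, x < 1, u * (x / (1 - x)) - x * (u + eps) <= - (x * (eps / 2))
    & u * (- x / (1 - - x)) - - x * (u - eps) <= - (x * (eps / 2))].
Proof.
move=> eps0 u0 uU x; have D0 : 0 < 2 * U + eps by lra.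
have x0 : 0 < x by rewrite divr_gt0.
have hx : x * (2 * U + eps) = eps by rewrite divfK// gt_eqF.
have Ux : 0 < U * x by rewrite mulr_gt0//; lra.
have x1 : x < 1 by rewrite ltr_pdivrMr// mul1r; lra.
have y0 : 0 < 1 - x by rewrite subr_gt0.
have z0 : 0 < 1 - - x by lra.
have q0 : 0 <= x / (1 - x) by rewrite divr_ge0 ?ltW.
have p0 : 0 <= x / (1 - - x) by rewrite divr_ge0 ?ltW.
have hq : x / (1 - x) * (1 - x) = x by rewrite divfK// gt_eqF.
have hp : x / (1 - - x) * (1 - - x) = x by rewrite divfK// gt_eqF.
rewrite mulNr; move: (x / (1 - x)) (x / (1 - - x)) q0 p0 hq hp => q p q0 p0 hq hp.
have Uq : U * q = eps / 2.
  apply: (@mulIf _ (1 - x)); first by rewrite gt_eqF.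
  by rewrite -mulrA hq; lra.
have uq : u * q * x <= eps / 2 * x by rewrite ler_wpM2r ?(ltW x0)// -Uq ler_wpM2r.
have px : p <= x by rewrite -[leRHS]hp; have := mulr_ge0 p0 (ltW x0); lra.
have up : u * p * x <= U * x * x.
  by rewrite ler_wpM2r ?(ltW x0)//; apply: ler_pM => //; exact: ltW.
have xx := mulr_ge0 (mulr_ge0 (ltW x0) (ltW x0)) (ltW eps0).
split => //.
- have : u * q - u * x = u * q * x by rewrite -[in u * x]hq; lra.
  lra.
- have : u * x - u * p = u * p * x by rewrite -[in u * x]hp; lra.
  have : x * x * (2 * U + eps) = x * eps by rewrite -mulrA hx.
  lra.
Qed.

Section PoissonProcess.
Context {R : realType} {disp : measure_display} {T : measurableType disp}
  (P : probability T R).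
Local Open Scope ereal_scope.

Lemma markov_ge0 (f : T -> \bar R) (B : set T) (c : R) : measurable_fun setT f ->
  (forall w, 0 <= f w) -> measurable B -> (0 < c)%R ->
  (forall w, B w -> c%:E <= f w) -> P B <= c^-1%:E * \int[P]_w f w.
Proof.
move=> mf f0 mB c0 Bf.
rewrite -lee_pdivrMl ?invr_gt0// invrK -integral_cst//.
apply: (@le_trans _ _ (\int[P]_(w in B) f w)).
  apply: ge0_le_integral => //; first by move=> w _; rewrite lee_fin ltW.
  exact: measurable_funTS.
exact: ge0_subset_integral.
Qed.

Section count.
Context (X : T -> nat) (mX : measurable_fun setT X).

Lemma measurable_preimage_nat (Y : set nat) : measurable (X @^-1` Y).
Proof. by rewrite -[X @^-1` Y]setTI; exact: mX. Qed.

Lemma measurable_comp_nat (f : nat -> R) : measurable_fun setT (fun w => f (X w)).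
Proof. by apply: (@measurableT_comp _ _ _ _ _ _ f) => // _ Y _; rewrite setTI. Qed.

Lemma expectation_count (f : nat -> R) : (forall k, 0 <= f k)%R ->
  \int[P]_w (f (X w))%:E = \sum_(0 <= k <oo) ((f k)%:E * P [set w | X w = k]).
Proof.
move=> f0; have cover : \bigcup_k (X @^-1` [set k]) = setT.
  by apply/seteqP; split => // w _; exists (X w).
rewrite -cover ge0_integral_bigcup//.
- apply: eq_eseriesr => k _.
  rewrite (eq_integral (cst (f k)%:E)); last first.
    by move=> w; rewrite inE /= => ->.
  by rewrite integral_cst//; exact: measurable_preimage_nat.
- by move=> k; exact: measurable_preimage_nat.
- by rewrite cover; apply/measurable_EFinP; exact: measurable_comp_nat.
- by move=> w _; rewrite lee_fin.
- by apply/trivIsetP => i j _ _ /eqP ij; apply/seteqP; split => // w /= [-> /ij].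
Qed.

Context (s : R) (s_gt0 : (0 < s)%R)
  (pX : forall k, P [set w | X w = k] = (poisson_pmf s k)%:E).

Lemma poisson_generating_function (z : R) : (0 <= z)%R ->
  \int[P]_w (z ^+ X w)%:E = (expR (s * (z - 1)))%:E.
Proof.
move=> z0; rewrite (expectation_count (f := fun k => z ^+ k)%R); last first.
  by move=> k; rewrite exprn_ge0.
have -> : (expR (s * (z - 1)))%:E = (expR (- s))%:E * (expR (s * z))%:E.
  by rewrite -EFinM -expRD; congr (expR _)%:E; lra.
transitivity (\sum_(0 <= k <oo)
    ((expR (- s))%:E * ((s * z) ^+ k * (k`!%:R)^-1)%:E)).
  apply: eq_eseriesr => k _; rewrite pX /poisson_pmf s_gt0 -!EFinM exprMn.
  congr (_%:E); move: (z ^+ k)%R (s ^+ k)%R (_^-1)%R (expR _) => a b c e.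
  lra.
rewrite nneseriesZl; last first.
  by move=> k _; rewrite lee_fin divr_ge0// exprn_ge0// mulr_ge0// ltW.
congr (_ * _); rewrite expRE -EFin_lim; last first.
  rewrite /pseries/=; under eq_fun do rewrite mulrC.
  exact: is_cvg_series_exp_coeff.
apply/congr_lim/funext => n/=; rewrite /pseries/= /series/= -sumEFin//.
by under eq_bigr do rewrite mulrC.
Qed.

(** The generating function is taken at [z = 1 / (1 - x)], not at [expR x <= z], so that the
    exponent is rational in [x]. Negative [x] gives the lower tail. *)
Lemma poisson_chernoff (x c : R) : (x < 1)%R ->
  P [set w | (c <= x * (X w)%:R)%R] <= (expR (s * (x / (1 - x)) - c))%:E.
Proof.
move=> x1; pose z : R := ((1 - x)^-1)%R.
have z0 : (0 < z)%R by rewrite invr_gt0 subr_gt0.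
have mB : measurable [set w | (c <= x * (X w)%:R)%R].
  exact: (measurable_preimage_nat [set k | (c <= x * k%:R)%R]).
have zX k : (expR (x * k%:R) <= z ^+ k)%R.
  rewrite expRM_natr lerXn2r ?nnegrE ?expR_ge0 ?(ltW z0)//.
  rewrite -[x]opprK expRN lef_pV2 ?posrE ?expR_gt0 ?subr_gt0//.
  exact: expR_ge1Dx.
apply: le_trans (@markov_ge0 (fun w => (z ^+ X w)%:E) _ (expR c) _ _ mB _ _) _.
- by apply/measurable_EFinP; apply: (measurable_comp_nat (fun k => z ^+ k)%R).
- by move=> w; rewrite lee_fin exprn_ge0// ltW.
- exact: expR_gt0.
- by move=> w /= cw; rewrite lee_fin; apply: le_trans (zX _); rewrite ler_expR.
rewrite poisson_generating_function ?(ltW z0)// -EFinM lee_fin -expRN -expRD ler_expR.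
suff -> : (z - 1 = x / (1 - x))%R by lra.
rewrite /z -[X in (_ - X)%R](@mulfV _ (1 - x)%R); last by rewrite subr_eq0 gt_eqF.
by rewrite -[X in (X - _)%R]mul1r -mulrBl; congr (_ / _)%R; lra.
Qed.

End count.

Context (N : T -> R -> nat) (N_poisson : unit_poisson_process P N).
(** [N w 0 = 0] holds only almost surely, while the law of the increment is exact. Estimates are
    made for the increment and carried over to [N] off [poisson_irregular]. *)
Local Notation X t := (fun w => (N w t - N w 0%R)%N).

Lemma measurable_count t : (0 <= t)%R -> measurable_fun setT (X t).
Proof.
case: N_poisson => mN _ _ _ t0 _ Y _; rewrite setTI.
have -> : X t @^-1` Y = \bigcup_j ([set w | N w 0%R = j] `&`
    (fun w => N w t) @^-1` [set k | Y (k - j)%N]).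
  apply/seteqP; split => [w Yw|w [j _ [/= <-]]] //.
  by exists (N w 0%R).
apply: bigcup_measurable => j _; apply: measurableI.
  exact: (measurable_preimage_nat (mN 0%R (lexx _)) [set j]).
exact: measurable_preimage_nat (mN t t0) _.
Qed.

Lemma count_distribution t k : (0 < t)%R ->
  P [set w | X t w = k] = (poisson_pmf t k)%:E.
Proof. by case: N_poisson => _ _ _ H t0; rewrite (H 0%R t k)// subr0. Qed.

Definition poisson_irregular : set T :=
  [set w | ~ (N w 0%R = 0%N /\
    forall s t : R, (0 <= s)%R -> (s <= t)%R -> (N w s <= N w t)%N)].

Lemma poisson_irregular_negligible : P^*%mu poisson_irregular = 0.
Proof.
apply: outer_negligible; case: N_poisson => _ + _ _.
by apply: negligibleS => w /= H [h0 hm _]; apply: H.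
Qed.

Lemma poisson_deviation (u eps U : R) (n : nat) : (0 < n)%N -> (0 < eps)%R ->
  (0 < u)%R -> (u <= U)%R ->
  P^*%mu [set w | (eps < `|n%:R^-1 * (X (n%:R * u) w)%:R - u|)%R]
    <= (2 * expR (- (n%:R * (eps / (2 * U + eps) * (eps / 2)))))%:E.
Proof.
move=> n_gt0 eps0 u0 uU; have n0 : (0 < n%:R :> R)%R by rewrite ltr0n.
have s0 : (0 < n%:R * u)%R by rewrite mulr_gt0.
have mX := measurable_count (ltW s0).
have pX k := count_distribution k s0.
have [x0 x1 hup hlo] := chernoff_exponents eps0 u0 uU.
set x := (eps / (2 * U + eps))%R in x0 x1 hup hlo *.
set kap := (n%:R * (x * (eps / 2)))%R.
have Nx1 : (- x < 1)%R by lra.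
pose dev (y c : R) := [set w | (n%:R * c <= y * (X (n%:R * u) w)%:R)%R].
have bound (y c : R) : (y < 1)%R -> (u * (y / (1 - y)) - c <= - (x * (eps / 2)))%R ->
    P^*%mu (dev y c) <= (expR (- kap))%:E.
  move=> y1 hc; rewrite measurable_mu_extE; last first.
    exact: (measurable_preimage_nat mX [set k | (n%:R * c <= y * k%:R)%R]).
  apply: le_trans (poisson_chernoff mX s0 pX _ y1) _.
  by rewrite lee_fin ler_expR /kap -mulrA -mulrBr -mulrN ler_pM2l.
have e_up := bound _ _ x1 hup.
have e_lo := bound _ _ Nx1 hlo.
apply: (@le_trans _ _ (P^*%mu (dev x (x * (u + eps))%R `|` dev (- x)%R (- x * (u - eps))%R))).
  apply: le_outer_measure => w /=.
  set y := (_ - N w 0)%N => H.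
  have {H} : (u + eps <= n%:R^-1 * y%:R \/ n%:R^-1 * y%:R <= u - eps)%R.
    by move: H; rewrite ltr_normr => /orP[H|H]; [left|right]; lra.
  rewrite /dev /= -/y; case => H; [left|right].
    by rewrite mulrCA ler_pM2l// -ler_pdivlMl.
  by rewrite mulrCA !mulNr lerN2 ler_pM2l// -ler_pdivrMl.
have -> : (2 * expR (- kap) = expR (- kap) + expR (- kap))%R by lra.
exact: outer_leU.
Qed.

Section uniform_deviation.
Local Open Scope ring_scope.

(** Between grid points monotonicity costs one mesh, at most [delta / 2]. The grid goes one mesh
    beyond [U], since the cell that contains [u = U] ends there. *)
Lemma grid_control (N0 : R -> nat) (n m : nat) (U delta : R) :
  (0 < n)%N -> 0 < U -> 0 < delta ->
  (forall s t : R, 0 <= s -> s <= t -> (N0 s <= N0 t)%N) ->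
  2 * U / delta <= m.+1%:R ->
  (forall k, (k <= m.+1)%N ->
     `|n%:R^-1 * (N0 (n%:R * (k.+1%:R * (U / m.+1%:R))))%:R - k.+1%:R * (U / m.+1%:R)|
       <= delta / 2) ->
  forall u, 0 <= u <= U -> `|n%:R^-1 * (N0 (n%:R * u))%:R - u| <= delta.
Proof.
move=> n_gt0 U0 d0 N0mono md Hk u /andP[u0 uU].
have n0 : 0 < n%:R :> R by rewrite ltr0n.
have h0 : 0 < U / m.+1%:R by rewrite divr_gt0.
have hd : U / m.+1%:R <= delta / 2.
  rewrite ler_pdivrMr//; move: md; rewrite ler_pdivrMr//; lra.
have hm : m.+1%:R * (U / m.+1%:R) = U by rewrite mulrCA mulfV ?mulr1// pnatr_eq0.
set h := U / m.+1%:R in h0 hd hm Hk.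
have mono s t : 0 <= s -> s <= t ->
    n%:R^-1 * (N0 (n%:R * s))%:R <= n%:R^-1 * (N0 (n%:R * t))%:R :> R.
  move=> s0 st; rewrite ler_pM2l ?invr_gt0// ler_nat N0mono ?ler_pM2l//.
  by rewrite mulr_ge0// ltW.
have uh0 : 0 <= u / h by rewrite divr_ge0// ltW.
pose k := Num.truncn (u / h).
have /andP[ku uk] := truncn_itv uh0; rewrite -/k in ku uk.
rewrite ler_pdivlMr// in ku; rewrite ltr_pdivrMr// in uk.
have km : (k <= m.+1)%N.
  rewrite -(@ler_nat R) -(@ler_pM2r _ h)//; apply: le_trans ku _.
  by rewrite hm.
have kh1 : k.+1%:R * h = k%:R * h + h by rewrite -natr1 mulrDl mul1r.
have up := Hk k km; have up' := mono _ _ u0 (ltW uk).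
rewrite ler_norml; apply/andP; split; last first.
  move: up; rewrite ler_norml => /andP[_ up]; lra.
(* In the first cell no estimate at the left end is needed: [u] itself is at most [delta / 2]
   there. *)
case: k => [|k] in ku uk km kh1 up up' *.
  have : 0 <= n%:R^-1 * (N0 (n%:R * u))%:R :> R by rewrite mulr_ge0// invr_ge0 ltW.
  move: kh1; rewrite mul0r; lra.
have := Hk k (ltnW km); rewrite ler_norml => /andP[lo _].
have kh0 : 0 <= k.+1%:R * h by rewrite mulr_ge0// ltW.
have := mono _ _ kh0 ku; lra.
Qed.

End uniform_deviation.

Section excess.
Context (A : R) (A_ge8 : (8 <= A)%R).

(* [N u <= A * u + \sum_j excess j] for all [u], and [excess j] is of expected size
   [(4 / A) / 2 ^ j]. *)
Definition excess (j : nat) (w : T) : \bar R := (X (j.+1%:R / A)%R w - j)%N%:R%:E.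

Let A0 : (0 < A)%R. Proof. by apply: lt_le_trans A_ge8. Qed.

Lemma measurable_excess j : measurable_fun setT (excess j).
Proof.
apply/measurable_EFinP.
have s0 : (0 <= j.+1%:R / A)%R by rewrite divr_ge0// ltW.
exact: (measurable_comp_nat (measurable_count s0) (fun k => (k - j)%N%:R%R)).
Qed.

(** For [k = j + p] with [p > 0] this is [p <= A ^+ (p - 1)]. It dominates the truncated excess by a
    power, whose mean is the generating function at [A]. *)
Lemma nat_excess_le (j k : nat) : ((k - j)%N%:R * A ^+ j.+1 <= A ^+ k)%R.
Proof.
have [kj|jk] := leqP k j.
  by move: kj; rewrite -subn_eq0 => /eqP ->; rewrite mul0r exprn_ge0// ltW.
rewrite -[in (A ^+ k)%R](subnKC jk) exprD mulrC ler_wpM2l ?exprn_ge0 ?(ltW A0)//.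
have -> : (k - j)%N = (k - j.+1).+1 by rewrite subnS prednK// subn_gt0.
elim: (k - j.+1)%N => [|p IH]; first by rewrite expr0.
rewrite exprS -natr1; have p1 : (1 <= p.+1%:R :> R)%R by rewrite ler1n.
have : (2 * p.+1%:R <= A * A ^+ p)%R.
  by apply: ler_pM => //; apply: le_trans A_ge8; rewrite ler_nat.
lra.
Qed.

(** The mean is at most [A ^- j.+1 * expR 1 ^+ j.+1 <= (4 / A) ^+ j.+1], and [4 / A <= 1 / 2]. The
    crude [expR 1 <= 4] comes from [expR (- (1 / 2)) >= 1 / 2]. *)
Lemma integral_excess j :
  \int[P]_w excess j w <= (4 / A * 2^-1 ^+ j)%:E.
Proof.
have s0 : (0 < j.+1%:R / A)%R by rewrite divr_gt0.
have mX := measurable_count (ltW s0).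
have pX k := count_distribution k s0.
apply: (@le_trans _ _ (\int[P]_w ((A ^- j.+1)%:E * (A ^+ X (j.+1%:R / A)%R w)%:E))).
  apply: ge0_le_integral => //.
  - by move=> w _; rewrite lee_fin.
  - exact: measurable_excess.
  - apply: measurable_funeM; apply/measurable_EFinP.
    exact: (measurable_comp_nat mX (fun k => A ^+ k)%R).
  - move=> w _; rewrite /excess -EFinM lee_fin [leRHS]mulrC ler_pdivlMr ?exprn_gt0//.
    exact: nat_excess_le.
rewrite ge0_integralZl_EFin//; last 3 first.
- by move=> w _; rewrite lee_fin exprn_ge0// ltW.
- by apply/measurable_EFinP; exact: (measurable_comp_nat mX (fun k => A ^+ k)%R).
- by rewrite invr_ge0 exprn_ge0// ltW.
rewrite (poisson_generating_function mX s0 pX (ltW A0)) -EFinM lee_fin.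
have e4 : (expR 1 <= 4 :> R)%R.
  have -> : (1 = 2%:R * (1 / 2) :> R)%R by rewrite mulrC divfK.
  rewrite expRM_natl.
  have : (expR (1 / 2) <= 2 :> R)%R.
    rewrite -[(1 / 2)%R]opprK expRN -[leRHS]invrK lef_pV2 ?posrE ?invr_gt0 ?expR_gt0//.
    by apply: le_trans (expR_ge1Dx _); lra.
  have := expR_ge0 (1 / 2 : R); rewrite expr2 => h0 h1.
  have := ler_pM h0 h0 h1 h1; lra.
apply: (@le_trans _ _ (A ^- j.+1 * 4 ^+ j.+1)%R).
  rewrite ler_wpM2l ?invr_ge0 ?exprn_ge0 ?(ltW A0)//.
  apply: (@le_trans _ _ (expR 1 ^+ j.+1)%R); last by rewrite lerXn2r ?nnegrE ?expR_ge0.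
  rewrite -expRM_natl ler_expR mulr1 mulrAC ler_pdivrMr//.
  by rewrite ler_pM2l//; lra.
rewrite -exprVn -exprMn mulrC exprS ler_wpM2l ?divr_ge0 ?(ltW A0)//.
rewrite lerXn2r ?nnegrE ?divr_ge0 ?(ltW A0)//.
by rewrite ler_pdivrMr// mulrC ler_pdivlMr// -natrM.
Qed.

Definition total_excess (w : T) : \bar R := \sum_(0 <= j <oo) excess j w.

Lemma total_excess_ge0 w : 0 <= total_excess w.
Proof. by apply: nneseries_ge0 => j _ _; rewrite lee_fin. Qed.

Lemma measurable_total_excess : measurable_fun setT total_excess.
Proof.
apply: ge0_emeasurable_sum => [j w _|j _]; first by rewrite lee_fin.
exact: measurable_excess.
Qed.

Lemma integral_total_excess : \int[P]_w total_excess w <= (8 / A)%:E.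
Proof.
rewrite /total_excess integral_nneseries//; last 2 first.
- exact: measurable_excess.
- by move=> j w _; rewrite lee_fin.
apply: lime_le.
  by apply: is_cvg_nneseries => j _ _; apply: integral_ge0 => w _; rewrite lee_fin.
apply: nearW => n.
apply: (@le_trans _ _ (\sum_(0 <= j < n) (4 / A * 2^-1 ^+ j)%:E)).
  by apply: lee_sum => j _; exact: integral_excess.
rewrite sumEFin lee_fin -mulr_sumr.
suff : (\sum_(0 <= j < n) 2^-1 ^+ j <= 2 - 2 * 2^-1 ^+ n :> R)%R.
  move=> H; have -> : (8 / A = 4 / A * 2)%R by lra.
  rewrite ler_wpM2l ?divr_ge0 ?(ltW A0)//; apply: le_trans H _.
  by rewrite gerBl mulr_ge0// exprn_ge0// invr_ge0.
elim: n => [|n IH]; first by rewrite big_geq// expr0; lra.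
rewrite big_nat_recr//= exprS; lra.
Qed.

(** For [j <= A * u < j.+1], monotonicity bounds [N w u] by the count at [j.+1 / A], which is at
    most [j] plus the [j]-th excess. *)
Lemma count_le_total_excess w u : ~ poisson_irregular w -> (0 <= u)%R ->
  total_excess w < +oo -> ((N w u)%:R <= A * u + fine (total_excess w))%R.
Proof.
move=> /contrapT[N0 Nmono] u0 Zoo.
have Zfin : total_excess w \is a fin_num by rewrite ge0_fin_numE// total_excess_ge0.
have Au0 : (0 <= A * u)%R by rewrite mulr_ge0// ltW.
have /andP[ju uj] := truncn_itv Au0.
move: (Num.truncn (A * u)) ju uj => j ju uj.
have Nu : (N w u <= N w (j.+1%:R / A)%R)%N.
  by apply: Nmono => //; rewrite ler_pdivlMr// mulrC ltW.
have Ze : (((N w (j.+1%:R / A)%R) - j)%N%:R <= fine (total_excess w))%R.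
  rewrite -lee_fin fineK//.
  apply: le_trans (nneseries_lim_ge j.+1 _); last by move=> k _ _; rewrite lee_fin.
  rewrite big_nat_recr//= /excess N0 subn0 leeDr// sume_ge0//.
apply: (@le_trans _ _ (j%:R + ((N w (j.+1%:R / A)%R) - j)%N%:R)%R).
  by rewrite -natrD ler_nat; apply: leq_trans Nu _; rewrite -leq_subLR.
by rewrite lerD.
Qed.

End excess.
End PoissonProcess.

(** The threshold [n0] is chosen before the probability space and the process, because both vary
    with [n] in the application. *)
Lemma poisson_flln {R : realType} (U delta q : R) : 0 < U -> 0 < delta -> 0 < q ->
  exists n0 : nat, forall n, (n0 <= n)%N ->
  forall (disp : measure_display) (T : measurableType disp) (P : probability T R)
    (N : T -> R -> nat), unit_poisson_process P N ->
  (P^*%mu [set w | exists2 u : R, (0 <= u <= U)%R &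
     (delta < `|n%:R^-1 * (N w (n%:R * u))%:R - u|)%R] <= q%:E)%E.
Proof.
move=> U0 d0 q0; pose m := Num.truncn (2 * U / delta).
(* [x] is the exponential rate of [poisson_deviation] for accuracy [delta / 2] and horizon [U'],
   which lies beyond the last grid point. *)
pose U' := 2 * U + 2 * U; pose x := (delta / 2) / (2 * U' + delta / 2) * (delta / 2 / 2).
have x0 : 0 < x by rewrite !mulr_gt0// invr_gt0; rewrite /U'; lra.
have Uh : U + U / m.+1%:R <= U'.
  have : U / m.+1%:R <= U by rewrite ler_pdivrMr// ler_peMr ?ler1n// ltW.
  by move=> h; apply: le_trans (lerD (lexx U) h) _; rewrite /U'; lra.
(* Ensures [m.+2 * 2 <= q * (n * x)]; with [n * x <= expR (n * x)] the union bound over the [m.+2]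
   grid points is at most [q]. *)
pose n0 := (Num.truncn (m.+2%:R * 2 / (q * x))).+1.
exists n0 => n nn0 disp T P N NP.
have n_gt0 : (0 < n)%N by rewrite (leq_trans _ nn0).
have mU : 2 * U / delta <= m.+1%:R by rewrite ltW// truncnS_gt.
have h0 : 0 < U / m.+1%:R by rewrite divr_gt0.
pose F k := [set w | delta / 2 < `|n%:R^-1 *
  (N w (n%:R * (k.+1%:R * (U / m.+1%:R)))%R - N w 0%R)%N%:R - k.+1%:R * (U / m.+1%:R)|].
apply: (@le_trans _ _ (P^*%mu (poisson_irregular N `|`
    \big[setU/set0]_(k < m.+2) F k))).
  apply: le_outer_measure => w [u uU du].
  apply: contrapT => /not_orP[/contrapT[N0 Nmono] wF].
  move: du; apply/negP; rewrite -leNgt.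
  apply: (grid_control n_gt0 U0 d0 Nmono mU) => // k km.
  rewrite leNgt; apply/negP => Fk; apply: wF.
  rewrite -bigcup_mkord; exists k => //.
  by rewrite /F /= N0 subn0.
have irr : (P^*%mu (poisson_irregular N) <= 0%:E)%E.
  by rewrite (poisson_irregular_negligible NP).
rewrite -[q]add0r; apply: outer_leU => //.
have Fb k : (k < m.+2)%N -> (P^*%mu (F k) <= (2 * expR (- (n%:R * x)))%:E)%E.
  move=> km; apply: (poisson_deviation NP) => //.
  - by rewrite divr_gt0.
  - by rewrite mulr_gt0.
  - apply: (@le_trans _ _ (m.+2%:R * (U / m.+1%:R))).
      by rewrite ler_pM2r// ler_nat.
    by rewrite -natr1 mulrDl mul1r mulrCA mulfV ?pnatr_eq0// mulr1.
apply: le_trans (outer_le_bigsetU Fb) _.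
rewrite lee_fin mulrA expRN ler_pdivrMr ?expR_gt0//.
have : m.+2%:R * 2 / (q * x) <= n%:R :> R.
  apply: le_trans (ltW (truncnS_gt _)) _; rewrite ler_nat.
  exact: nn0.
have qx0 : 0 < q * x by exact: mulr_gt0 q0 x0.
rewrite ler_pdivrMr// => /le_trans; apply.
rewrite mulrCA ler_pM2l//; apply: le_trans (expR_ge1Dx _).
by rewrite lerDr.
Qed.

(** Markov's inequality for the sum of the [m] total excesses. It controls the sum of the [z i],
    where a union bound would control them only one at a time. *)
Lemma poisson_sum_excess {R : realType} (disp : measure_display)
    (T : measurableType disp) (P : probability T R) (N : nat -> T -> R -> nat)
    (A y : R) (m : nat) : (forall i, unit_poisson_process P (N i)) ->
  8 <= A -> 0 < y ->
  exists2 B : set T, (P^*%mu B <= (m%:R * (8 / A) / y)%:E)%E &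
    forall w, ~ B w -> exists z : nat -> R,
      [/\ forall i, 0 <= z i, forall M, \sum_(0 <= i < M) z i <= y
        & forall i u, (i < m)%N -> 0 <= u -> (N i w u)%:R <= A * u + z i].
Proof.
move=> NP A8 y0.
pose Z i := total_excess (N i) A.
pose W w := (\sum_(i < m) Z i w)%E.
have Z0 i w : (0 <= Z i w)%E by exact: total_excess_ge0.
have mZ i : measurable_fun setT (Z i) by exact: measurable_total_excess.
have mW : measurable_fun setT W by exact: emeasurable_sum.
have W0 w : (0 <= W w)%E by apply: sume_ge0.
pose B1 := [set w | (y%:E <= W w)%E].
have mB1 : measurable B1.
  by rewrite -[B1]setTI; apply: emeasurable_fun_c_infty.
exists (B1 `|` \big[setU/set0]_(i < m) poisson_irregular (N i)).
  rewrite -[X in X%:E]addr0; apply: outer_leU.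
    rewrite measurable_mu_extE//; apply: le_trans (markov_ge0 P mW W0 mB1 y0 _) _ => //.
    rewrite mulrC EFinM lee_pmul2l ?lte_fin ?invr_gt0// ge0_integral_sum//.
    apply: (@le_trans _ _ (\sum_(i < m) (8 / A)%:E)%E).
      by apply: lee_sum => i _; exact: integral_total_excess.
    by rewrite sumEFin lee_fin sumr_const card_ord (mulr_natl _ m).
  rewrite -(mulr0 m%:R).
  apply: (@outer_le_bigsetU _ _ _ P (fun i => poisson_irregular (N i)) m 0) => i _.
  by rewrite poisson_irregular_negligible.
move=> w /not_orP[/negP]; rewrite -ltNge => Wy Hirr.
have ZW i : (i < m)%N -> (Z i w <= W w)%E.
  move=> im; rewrite /W (bigD1 (Ordinal im))//= leeDl// sume_ge0//.
have Zoo i : (i < m)%N -> (Z i w < +oo)%E.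
  by move=> /ZW /le_lt_trans; apply; apply: lt_trans Wy (ltry _).
have Zfin i : (i < m)%N -> Z i w \is a fin_num.
  by move=> im; rewrite ge0_fin_numE// Zoo.
(* The value 0 from [m] on makes the bound hold for partial sums of every length. *)
exists (fun i => if (i < m)%N then fine (Z i w) else 0); split.
- by move=> i; case: ifP => // _; rewrite fine_ge0.
- move=> M; apply: (@le_trans _ _ (\sum_(0 <= i < m) fine (Z i w))).
    rewrite -big_mkcond /=; have [mM|Mm] := leqP m M.
      by rewrite (big_nat_widen _ _ _ _ _ mM).
    rewrite [leRHS](@big_cat_nat _ _ _ M)//=; last exact: ltnW.
    rewrite -[leLHS]addr0 lerD ?sumr_ge0//; last by move=> i _; rewrite fine_ge0.
    rewrite big_mkcond; apply: ler_sum => i _; case: ifP => // _.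
    by rewrite fine_ge0.
  rewrite -lee_fin; apply: le_trans (ltW Wy); rewrite /W -sumEFin big_mkord.
  by apply: lee_sum => i _; rewrite fineK// Zfin.
- move=> i u im u0; rewrite im; apply: count_le_total_excess => //.
    by move=> irr; apply: Hirr;
      rewrite -(bigcup_mkord m (fun i => poisson_irregular (N i))); exists i.
  exact: Zoo.
Qed.

(* Needed because [skorohod_dist] integrates functions whose measurability is not known. *)
Lemma ge0_le_integral_nonmeasurable {R : realType} (disp : measure_display)
    (T : measurableType disp) (mu : {measure set T -> \bar R}) (D : set T)
    (f g : T -> \bar R) :
  (forall x, D x -> 0 <= f x)%E -> (forall x, D x -> f x <= g x)%E ->
  (\int[mu]_(x in D) f x <= \int[mu]_(x in D) g x)%E.
Proof.
move=> f0 fg; rewrite !ge0_integralE//; last first.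
  by move=> x Dx; apply: le_trans (f0 x Dx) (fg x Dx).
apply: ereal_sup_le => _ [h hf <-]; exists h => // x.
apply: le_trans (hf x) _; rewrite /patch; case: ifPn => // /set_mem; exact: fg.
Qed.

(** * The Skorohod distance against the uniform distance on a bounded interval *)

Section SkorohodBound.
Context {R : realType} {E : Type} (dist : E -> E -> \bar R).
Context (dist_ge0 : forall a b, (0 <= dist a b)%E).
Local Notation mu := (@lebesgue_measure R).

Lemma log_slope_id : (log_slope (@id R) <= 0)%E.
Proof.
apply: ge_ereal_sup => _ [s [t [s0 st ->]]].
by rewrite divff ?ln1 ?normr0// subr_eq0 gt_eqF.
Qed.

Lemma time_change_id : time_change (@id R).
Proof. by split => //; rewrite image_id. Qed.

Lemma skorohod_dist_le_uniform (x y : R -> E) (delta T : R) :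
  0 <= delta -> 0 <= T ->
  (forall t, 0 <= t <= T -> (dist (x t) (y t) <= delta%:E)%E) ->
  (skorohod_dist dist x y <= (delta + 2 * expR (- (T / 2)))%:E)%E.
Proof.
move=> d0 T0 xy.
apply: (@le_trans _ _ (maxe (log_slope id)
    (\int[mu]_(u in `[0%R, +oo[) ((expR (- u))%:E * stopped_dist dist x y id u))%E)).
  by apply: ereal_inf_lbound; exists id => //; exact: time_change_id.
rewrite ge_max; apply/andP; split.
  apply: le_trans log_slope_id _.
  by rewrite lee_fin addr_ge0// mulr_ge0// expR_ge0.
(* A majorant on the whole half-line, made of two exponential densities of integral 1. Beyond [T]
   the stopped distance is capped by 1, and [expR (- u) <= expR (- (T / 2)) * expR (- (u / 2))]. *)
pose g u := delta * exponential_pdf 1 u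
  + 2 * expR (- (T / 2)) * exponential_pdf (2^-1) u.
have half0 : 0 <= 2^-1 :> R by rewrite invr_ge0.
have stop_le1 u : (stopped_dist dist x y id u <= 1)%E.
  by apply: ge_ereal_sup => _ [t _ <-]; rewrite ge_min lexx orbT.
have stop_ge0 u : (0 <= stopped_dist dist x y id u)%E.
  apply: le_ereal_sup_tmp; exists (mine (dist (x (Num.min 0 u)) (y (Num.min 0 u))) 1%E).
    by exists 0 => //=.
  by rewrite le_min dist_ge0 lee01.
have stop_le u : 0 <= u <= T -> (stopped_dist dist x y id u <= delta%:E)%E.
  move=> /andP[u0 uT]; apply: ge_ereal_sup => _ [t /= t0 <-].
  rewrite ge_min xy// le_min t0 u0 /= ge_min uT orbT.
  by [].
apply: (@le_trans _ _ (\int[mu]_(u in `[0%R, +oo[) (g u)%:E)%E).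
  apply: ge0_le_integral_nonmeasurable => u /=; rewrite in_itv /= andbT => u0.
    by rewrite mule_ge0// lee_fin expR_ge0.
  rewrite /g !exponential_pdfE// mulN1r mul1r.
  have e0 : 0 <= 2 * expR (- (T / 2)) * (2^-1 * expR (- 2^-1 * u)) :> R.
    by rewrite !mulr_ge0 ?expR_ge0.
  have [uT|Tu] := leP u T.
    apply: (@le_trans _ _ ((expR (- u))%:E * delta%:E)%E).
      by rewrite lee_pmul2l ?lte_fin ?expR_gt0// stop_le// u0.
    by rewrite -EFinM lee_fin mulrC lerDl.
  apply: (@le_trans _ _ ((expR (- u))%:E * 1)%E).
    by rewrite lee_pmul2l ?lte_fin ?expR_gt0.
  rewrite mule1 lee_fin.
  have -> : 2 * expR (- (T / 2)) * (2^-1 * expR (- 2^-1 * u)) =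
      expR (- (T / 2)) * expR (- 2^-1 * u) :> R.
    by rewrite mulrACA mulfV ?mul1r.
  rewrite -expRD; apply: ler_wpDl; first by rewrite mulr_ge0 ?expR_ge0.
  by rewrite ler_expR; lra.
apply: (@le_trans _ _ (\int[mu]_u (g u)%:E)%E).
  apply: ge0_subset_integral => //.
    apply/measurable_EFinP; apply: measurable_funD; apply: measurable_funM => //;
      exact: measurable_exponential_pdf.
  by move=> u _; rewrite lee_fin addr_ge0// !mulr_ge0 ?expR_ge0 ?exponential_pdf_ge0.
under eq_integral do rewrite /g EFinD !(EFinM _ (exponential_pdf _ _)).
set c := 2 * expR _; have c0 : 0 <= c by rewrite mulr_ge0 ?expR_ge0.
have pdf0 (a : R) u : 0 <= a -> (0 <= (exponential_pdf a u)%:E)%E.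
  by move=> a0; rewrite lee_fin exponential_pdf_ge0.
have mpdf (a : R) : measurable_fun setT (fun u => (exponential_pdf a u)%:E).
  by apply/measurable_EFinP; exact: measurable_exponential_pdf.
rewrite ge0_integralD//; last 4 first.
- by move=> u _; apply: mule_ge0; [rewrite lee_fin|exact: pdf0].
- by apply: measurable_funeM; exact: mpdf.
- by move=> u _; apply: mule_ge0; [rewrite lee_fin|exact: pdf0].
- by apply: measurable_funeM; exact: mpdf.
rewrite !ge0_integralZl_EFin//; try exact: mpdf; try by move=> u _; exact: pdf0.
by rewrite !integral_exponential_pdf ?invr_gt0// !mule1.
Qed.

End SkorohodBound.

(** * Limits with geometric errors, and splitting of sums into head and tail *)

Section Auxiliary.
Context {R : realType}.

Lemma approx_solution_weaken lam r (T T' eta eta' : R) G V :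
  T' <= T -> eta <= eta' ->
  approx_solution lam r T eta G V -> approx_solution lam r T' eta' G V.
Proof.
move=> TT ee [mG G01 VM HG HV].
have sub (t : R) : 0 <= t <= T' -> 0 <= t <= T.
  by move=> /andP[-> /le_trans]; apply.
have ei i : eta * 2 ^+ i <= eta' * 2 ^+ i by rewrite ler_wpM2r// exprn_ge0.
split.
- by move=> i; exact: measurable_itv0 TT (mG i).
- by move=> i t /sub; exact: G01.
- by move=> i; have [M H] := VM i; exists M => t /sub; exact: H.
- by move=> i t /sub tT; apply: le_trans (ei i); exact: HG.
- by move=> i t /sub tT; apply: le_trans (ei i); exact: HV.
Qed.

Lemma eventually_expr_le (d : nat -> nat) (c b e : R) :
  d n @[n --> \oo] --> \oo -> 0 <= c -> 0 <= b < 1 -> 0 < e ->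
  \forall n \near \oo, c * b ^+ d n <= e.
Proof.
move=> d_oo c0 /andP[b0 b1] e0.
have b1' : `|b| < 1 by rewrite ger0_norm.
have /cvgrPdist_le/(_ e e0) := cvg_geometric c b1'.
move=> /d_oo; rewrite /nbhs /=; apply: filterS => n /=.
rewrite sub0r normrN ger0_norm// mulr_ge0// exprn_ge0//.
Qed.

Lemma exists_expr2_ge (a b : R) : 0 < b -> exists m : nat, a <= b * 2 ^+ m.
Proof.
move=> b0; exists (Num.truncn (a / b)).+1; rewrite mulrC -ler_pdivrMr//.
apply: le_trans (ltW (truncnS_gt _)) _.
by rewrite -natrX ler_nat; apply: ltnW; exact: ltn_expl.
Qed.

Lemma cvge0_of_le (U : Type) (F : set_system U) (FF : Filter F)
    (f : U -> \bar R) :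
  (forall s, 0 <= f s)%E ->
  (forall e : R, 0 < e -> \forall s \near F, (f s <= e%:E)%E) ->
  (f @ F --> 0)%E.
Proof.
move=> f0 H; apply/fine_cvgP; split.
  have := H 1 ltr01; apply: filterS => s fs.
  by rewrite ge0_fin_numE// (le_lt_trans fs)// ltry.
apply/cvgrPdist_le => e e0; have := H e e0; apply: filterS => s fs.
have sfin : f s \is a fin_num by rewrite ge0_fin_numE// (le_lt_trans fs)// ltry.
by rewrite sub0r normrN ger0_norm ?fine_ge0// -lee_fin fineK.
Qed.

Lemma geometric_cauchy_limit (u : nat -> R) (c : R) (k0 : nat) : 0 <= c ->
  (forall k l, (k0 <= k)%N -> (k0 <= l)%N ->
     `|u k - u l| <= c * (2 ^- k + 2 ^- l)) ->
  (u n @[n --> \oo] --> limn u) /\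
  forall k, (k0 <= k)%N -> `|u k - limn u| <= c * 2 ^- k.
Proof.
move=> c0 H.
have half1 : `|2^-1 : R| < 1 by rewrite ger0_norm ?invr_ge0// invf_lt1// ltr1n.
have small e : 0 < e -> \forall n \near \oo, c * 2 ^- n <= e.
  move=> e0; have /cvgrPdist_le/(_ e e0) := cvg_geometric c half1.
  apply: filterS => n /=; rewrite sub0r normrN -exprVn ger0_norm//.
  by rewrite mulr_ge0// exprn_ge0// invr_ge0.
have uc : u n @[n --> \oo] --> limn u.
  apply: cauchy_cvg; apply/cauchy_exP => e e0.
  have e20 : 0 < e / 4 by rewrite divr_gt0.
  have [N _ HN] := small _ e20.
  pose m := maxn N k0; exists (u m).
  exists m => // n /= mn; rewrite /ball /=.
  have := H m n (leq_maxr _ _) (leq_trans (leq_maxr _ _) mn).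
  have := HN m (leq_maxl _ _); have := HN n (leq_trans (leq_maxl _ _) mn).
  rewrite /= mulrDr; lra.
split=> // k kk0; apply/ler_addgt0Pr => e e0.
have [N _ HN] := small _ (divr_gt0 e0 (ltr0Sn R 1)).
have /cvgrPdist_le/(_ _ (divr_gt0 e0 (ltr0Sn R 1)))[N' _ HN'] := uc.
pose l := maxn k0 (maxn N N').
have := H k l kk0 (leq_maxl _ _).
have := HN l (leq_trans (leq_maxl _ _) (leq_maxr _ _)).
have := HN' l (leq_trans (leq_maxr _ _) (leq_maxr _ _)).
move=> /= h1 h2 h3.
apply: le_trans (ler_distD (u l) _ _) _; rewrite (distrC (u l)).
move: h3; rewrite mulrDr; lra.
Qed.

Lemma sum_le_head_tail (x : nat -> R) (a b : R) (K : nat) :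
  (forall i, 0 <= x i) -> 0 <= a -> (forall i, (i < K)%N -> x i <= a) ->
  (forall M, \sum_(K <= i < M) x i <= b) ->
  forall n, \sum_(0 <= i < n) x i <= K%:R * a + b.
Proof.
move=> x0 a0 xa xb n.
have b0 : 0 <= b by have := xb 0%N; rewrite big_geq.
have head m : (m <= K)%N -> \sum_(0 <= i < m) x i <= K%:R * a.
  move=> mK; apply: (@le_trans _ _ (\sum_(0 <= i < m) a)).
    rewrite big_nat [leRHS]big_nat; apply: ler_sum => i /andP[_ im].
    by apply: xa; exact: leq_trans im mK.
  by rewrite sumr_const_nat subn0 -[leLHS]mulr_natl ler_wpM2r// ler_nat.
have [nK|/ltnW Kn] := leqP n K; first by rewrite -[leLHS]addr0 lerD// head.
by rewrite (@big_cat_nat _ _ _ K)//= lerD// head.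
Qed.

Lemma sum_tail_le (x : nat -> R) (b : R) (K K' : nat) : (K <= K')%N ->
  (forall i, 0 <= x i) -> (forall M, \sum_(K <= i < M) x i <= b) ->
  forall M, \sum_(K' <= i < M) x i <= b.
Proof.
move=> KK x0 xb M; have [K'M|MK'] := leqP K' M; last first.
  by rewrite big_geq ?(ltnW MK')//; have := xb 0%N; rewrite big_geq.
apply: le_trans (xb M); rewrite [leRHS](@big_cat_nat _ _ _ K')//= lerDr.
exact: sumr_ge0.
Qed.

Lemma lipschitz_norm (f : R -> R) (L : R) :
  (forall s t, 0 <= s -> s <= t -> `|f t - f s| <= L * (t - s)) ->
  forall s t, 0 <= s -> 0 <= t -> `|f s - f t| <= L * `|s - t|.
Proof.
move=> H s t s0 t0; have [st|ts] := leP s t.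
  by rewrite distrC [`|s - t|]distrC [X in _ * X]ger0_norm ?H// subr_ge0.
by rewrite [X in _ * X]ger0_norm ?H// ?subr_ge0// ltW.
Qed.

End Auxiliary.

(** * Choice of constants, existence of the fluid limit, and convergence *)

Section FluidLimitProof.
Context {R : realType} {disp : nat -> measure_display}
  {T : forall n, measurableType (disp n)} {P : forall n, probability (T n) R}
  {lambda : nat -> R} {d : nat -> nat} {G : forall n, T n -> R -> nat -> R}
  {lam : R} {r : nat -> R}
  (lambda_gt0 : forall n, (0 < n)%N -> 0 < lambda n)
  (d_bound : forall n, (0 < n)%N -> (1 <= d n <= n)%N)
  (G_jsq : forall n, (0 < n)%N ->
    jsq_process (P n) n (d n) (lambda n) (G n))
  (lam_gt0 : 0 < lam)
  (r_l1 : l1_down r)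
  (G0_cvg : cvg_in_probability P (lp_dist 1%E) (fun n w => G n w 0) r)
  (lambda_cvg : lambda n @[n --> \oo] --> lam)
  (d_cvg : d n @[n --> \oo] --> \oo).

Local Arguments G : clear implicits.

Lemma initial_condition_close (delta q : R) : 0 < delta -> 0 < q ->
  \forall n \near \oo,
    ((P n)^*%mu [set w | delta%:E < lp_dist 1%E (G n w 0%R) r] <= q%:E)%E.
Proof.
move=> d0 q0; have := G0_cvg d0.
move=> /fine_cvgP[fin] /cvgrPdist_le/(_ q q0); apply: filterS2 fin => n fin.
rewrite sub0r normrN => H; rewrite -(fineK fin) lee_fin.
by apply: le_trans H; exact: ler_norm.
Qed.

Lemma lambda_close (delta : R) : 0 < delta ->
  \forall n \near \oo, `|lambda n - lam| <= delta.
Proof.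
move=> d0; have /cvgrPdist_le/(_ _ d0) := lambda_cvg.
by apply: filterS => n; rewrite distrC.
Qed.

(** The last three clauses are kept because monotone coordinates, [V 0 i = 0] and a Lipschitz
    constant free of [n] survive pointwise limits; the regularity of the fluid solution rests on
    them. *)
Lemma jsq_near_fluid (T0 eta kappa : R) : 0 < T0 -> 0 < eta -> 0 < kappa ->
  \forall n \near \oo, exists2 B : set (T n), ((P n)^*%mu B <= kappa%:E)%E &
    forall w, ~ B w -> exists V : R -> nat -> R,
      [/\ approx_solution lam r T0 eta (G n w) V,
          forall t, 0 <= t -> l1_down (G n w t),
          forall i, V 0 i = 0
        & forall i s t, 0 <= s -> s <= t ->
            0 <= V t i - V s i <= (lam + 1) * (t - s)].
Proof.
move=> T0_gt0 eta0 kappa0.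
(* Half of [eta] pays for the reflection error [2 * e], the other half for four errors [delta]. *)
pose e := Num.min (eta / 4) (1 / 2); pose delta := Num.min (eta / 8) 1.
have e01 : 0 < e < 1.
  by rewrite lt_min divr_gt0// divr_gt0//= gt_min; apply/orP; right; lra.
have ee : 2 * e <= eta / 2.
  have : e <= eta / 4 by rewrite ge_min lexx.
  lra.
have delta0 : 0 < delta by rewrite lt_min divr_gt0/=.
have delta1 : delta <= 1 by rewrite ge_min lexx orbT.
have deta : 4 * delta <= eta / 2.
  have : delta <= eta / 8 by rewrite ge_min lexx.
  lra.
pose Lam := lam + 1; pose U := T0 + Lam * T0.
have Lam0 : 0 < Lam by rewrite addr_gt0.
have LT0 : 0 < Lam * T0 by rewrite mulr_gt0.
have U0 : 0 < U by rewrite addr_gt0.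
have eta20 : 0 < eta / 2 by rewrite divr_gt0.
(* From [m] on the weight does the work. The first [m] coordinates cost [2 * m] Poisson events of
   probability [q], and [kappa / 2] is reserved for the initial condition. *)
have [m Hm] := exists_expr2_ge (2 + T0 + Lam * T0) eta20.
pose q := kappa / 4 / m.+1%:R.
have q0 : 0 < q by rewrite !divr_gt0.
have mq : kappa / 2 + m%:R * (q + q) <= kappa.
  have : m%:R * (q + q) <= m.+1%:R * (q + q).
    by rewrite ler_wpM2r ?ler_nat// addr_ge0// ltW.
  have : m.+1%:R * q = kappa / 4.
    by rewrite mulrC divfK// pnatr_eq0.
  lra.
have [n0 flln] := poisson_flln U0 delta0 q0.
(* The bound 1 gives [lambda n <= Lam]; [delta / T0] keeps the change of the external input up to
   [T0] below [delta]. *)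
have dT0 : 0 < Num.min 1 (delta / T0) by rewrite lt_min ltr01 divr_gt0.
have kappa20 : 0 < kappa / 2 by rewrite divr_gt0.
have e1 : 0 <= 1 - e < 1 by case/andP: e01 => *; rewrite subr_ge0 ltW//= gtrBl.
have e0 : 0 < e by case/andP: e01.
near=> n.
have n_gt0 : (0 < n)%N by near: n; exact: nbhs_infty_gt.
have nn0 : (n0 <= n)%N by near: n; exact: nbhs_infty_ge.
have ln : `|lambda n - lam| <= Num.min 1 (delta / T0) by near: n; exact: lambda_close.
have Le : Lam * T0 * (1 - e) ^+ d n <= e.
  by near: n; apply: eventually_expr_le => //; exact: ltW.
have G0n : ((P n)^*%mu [set w | delta%:E < lp_dist 1%E (G n w 0%R) r] <= (kappa / 2)%:E)%E.
  by near: n; exact: initial_condition_close.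
have lL : lambda n <= Lam.
  move: ln; rewrite le_min => /andP[+ _]; rewrite ler_norml /Lam; lra.
have lT : `|lambda n - lam| * T0 <= delta.
  by move: ln; rewrite le_min => /andP[_]; rewrite ler_pdivlMr.
have [_ [Nm [Np [NP _ ae]]]] := G_jsq n_gt0.
have dn := d_bound n_gt0; have [_ dn'] := andP dn.
pose B0 := ~` [set w | [/\ forall i, exists k : nat, G n w 0 i = k%:R / n%:R,
    cadlag_path l1_down (lp_dist 1%E) (G n w)
  & jsq_equation n (d n) (lambda n) (Nm ^~ w) (Np ^~ w) (G n w)]].
have B0q : ((P n)^*%mu B0 <= 0%:E)%E by rewrite (outer_negligible ae).
pose F (N : T n -> R -> nat) := [set w | exists2 u : R, 0 <= u <= U &
     delta < `|n%:R^-1 * (N w (n%:R * u))%:R - u|].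
pose B := B0 `|` ([set w | (delta%:E < lp_dist 1%E (G n w 0%R) r)%E] `|`
  \big[setU/set0]_(i < m) (F (Nm i) `|` F (Np i))).
exists B.
  apply: (@le_trans _ _ (0 + (kappa / 2 + m%:R * (q + q)))%:E); last first.
    by rewrite lee_fin add0r.
  do 2 apply: outer_leU => //.
  apply: (@outer_le_bigsetU _ _ _ (P n) (fun i => F (Nm i) `|` F (Np i))) => i _.
  by apply: outer_leU; apply: flln => //; have [] := NP i.
move=> w /not_orP[/contrapT path /not_orP[/negP]].
rewrite -leNgt => Gr wF.
have {}path : jsq_path n (d n) (lambda n) (Nm ^~ w) (Np ^~ w) (G n w) by exact: path.
have lam_n0 : 0 <= lambda n by exact/ltW/lambda_gt0.
exists (overflow n (d n) (lambda n) (G n w)); split.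
- have [_ _ r01] := r_l1.
  apply: (@approx_solution_weaken _ _ _ T0 T0 (eta / 2 + 2 * e)) => //.
    by rewrite -lerBrDl (le_trans ee)// lerBrDl -splitr.
  apply: (jsq_path_approx dn' lam_n0 path (Lam := Lam) (U := U) (delta := delta)
    (m := m)) => //.
  + exact: ltW.
  + exact: ltW.
  + by rewrite lerDl ltW.
  + by rewrite lerDr ltW.
  + by move=> i; rewrite -lee_fin; apply: le_trans (coord_le_lp_dist1 _ _ i) _.
  + move=> i u im uU; split; rewrite leNgt; apply/negP => H; apply: wF;
      rewrite -(bigcup_mkord m (fun i => F (Nm i) `|` F (Np i)));
      exists i => //; [left|right]; by exists u.
- by move=> t t0; case: path => _ [H _ _] _; exact: H.
- by move=> i; exact: overflow0.
- move=> i s t s0 st.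
  have /andP[-> /le_trans] := overflow_lipschitz dn' lam_n0 path i s0 st; apply.
  by rewrite ler_wpM2r// subr_ge0.
Unshelve. all: by end_near. Qed.

(** The number of Poisson processes involved is [n * c], so both excess bounds allow a sum
    proportional to [n]: the failure probabilities are then free of [n]. *)
Lemma jsq_tail (T0 eps kappa : R) : 0 < T0 -> 0 < eps -> 0 < kappa ->
  exists K : nat, \forall n \near \oo,
    exists2 B : set (T n), ((P n)^*%mu B <= kappa%:E)%E &
    forall w, ~ B w -> forall M t, 0 <= t <= T0 ->
      \sum_(K <= i < M) G n w t i <= eps.
Proof.
move=> T0_gt0 eps0 kappa0.
have [r_lp _ r01] := r_l1.
have [Sr Sr0 HSr] := lp_space1_sum r_lp.
have eps40 : 0 < eps / 4 by rewrite divr_gt0.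
have kappa40 : 0 < kappa / 4 by rewrite divr_gt0.
have [Nr HNr] := lp_space1_tail r_lp eps40.
pose Lam := lam + 1; pose S := Sr + 1.
have Lam0 : 0 < Lam by rewrite addr_gt0.
have LT0 : 0 < Lam * T0 by rewrite mulr_gt0.
pose b := S + 2 + Lam * T0.
have b0 : 0 < b by rewrite /b /S; lra.
(* [a] serves both as slope and as excess per queue. The number [c] of levels per queue grows with
   [a], but only linearly ([c <= b * a]), so the failure probability [c * (8 / a) / a] is at most
   [8 * b / a <= kappa / 4]. *)
pose a := 8 + 8 * b / (kappa / 4).
have bk0 : 0 < 8 * b / (kappa / 4) by rewrite divr_gt0// mulr_gt0.
have a8 : 8 <= a by rewrite lerDl ltW.
have a0 : 0 < a by exact: lt_le_trans a8.
pose C := S + a * (Lam * T0) + a.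
have C0 : 0 < C by rewrite /C; have := mulr_gt0 a0 LT0; rewrite /S; lra.
pose c := (Num.truncn C).+1.
have Cc : C < c%:R by exact: truncnS_gt.
have cC : c%:R <= C + 1.
  by rewrite /c -natr1 lerD2r truncn_le ltW.
have bad1 : c%:R * (8 / a) / a <= kappa / 4.
  have a1 : 1 <= a by apply: le_trans a8; rewrite ler1n.
  have ba : 8 * b / a <= kappa / 4.
    by rewrite ler_pdivrMr// [leRHS]mulrC -ler_pdivrMr// /a lerDr.
  apply: le_trans ba; rewrite mulrA ler_pM2r ?invr_gt0// ler_pdivrMr//.
  have : c%:R <= b * a.
    apply: le_trans cC _; rewrite /b /C.
    have : S + 1 <= (S + 1) * a by rewrite ler_peMr// /S; lra.
    lra.
  lra.
(* Chosen after [c], on the same levels: now an excess above [n * (eps / 4)] has probability at most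
   [kappa / 4]. *)
pose A2 := 8 + 8 * c%:R / (eps / 4) / (kappa / 4).
have c0 : 0 < c%:R :> R by rewrite ltr0n.
have A2b0 : 0 < 8 * c%:R / (eps / 4) / (kappa / 4) by rewrite !divr_gt0// mulr_gt0.
have A28 : 8 <= A2 by rewrite lerDl ltW.
have A20 : 0 < A2 by exact: lt_le_trans A28.
have bad2 : c%:R * (8 / A2) / (eps / 4) <= kappa / 4.
  rewrite mulrA [_ * 8]mulrC mulrAC ler_pdivrMr// [leRHS]mulrC -ler_pdivrMr//.
  by rewrite /A2 lerDr.
pose delta := Num.min 1 (eps / 4).
have delta0 : 0 < delta by rewrite lt_min ltr01.
(* [K1] yields [2 * C <= K.+1], and [Nr] makes the tail of [r] at most [eps / 4]; neither depends on
   [n]. *)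
pose K1 := (Num.truncn (2 * C)).
pose K := maxn K1 Nr; exists K.+1.
have KC : 2 * C <= K.+1%:R.
  by apply: le_trans (ltW (truncnS_gt _)) _; rewrite ler_nat ltnS leq_maxl.
have half : 0 <= (2^-1 : R) < 1 by rewrite invr_ge0 ler0n/= invf_lt1// ltr1n.
have Alt : 0 <= A2 * (Lam * T0) by rewrite mulr_ge0// ltW.
near=> n.
have n_gt0 : (0 < n)%N by near: n; exact: nbhs_infty_gt.
have ln : `|lambda n - lam| <= 1 by near: n; exact: lambda_close.
have Le : A2 * (Lam * T0) * 2^-1 ^+ d n <= eps / 4.
  by near: n; apply: eventually_expr_le.
have G0n : ((P n)^*%mu [set w | delta%:E < lp_dist 1%E (G n w 0%R) r] <= (kappa / 4)%:E)%E.
  by near: n; exact: initial_condition_close.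
have lL : lambda n <= Lam by move: ln; rewrite ler_norml /Lam; lra.
have n0 : 0 < n%:R :> R by rewrite ltr0n.
pose m := (n * c)%N.
have Cm : n%:R * C < m%:R by rewrite /m natrM ltr_pM2l.
have na0 : 0 < n%:R * a by rewrite mulr_gt0.
have ne0 : 0 < n%:R * (eps / 4) by rewrite mulr_gt0.
have scale (x y : R) : m%:R * x / (n%:R * y) = c%:R * x / y.
  by rewrite /m natrM -[n%:R * _ * x]mulrA -mulf_div mulfV ?mul1r ?gt_eqF.
have kk : 0 + (kappa / 4 + (kappa / 4 + kappa / 4)) <= kappa by lra.
have [_ [Nm [Np [NP _ ae]]]] := G_jsq n_gt0.
have dn := d_bound n_gt0; have [_ dn'] := andP dn.
pose B0 := ~` [set w | [/\ forall i, exists k : nat, G n w 0 i = k%:R / n%:R,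
    cadlag_path l1_down (lp_dist 1%E) (G n w)
  & jsq_equation n (d n) (lambda n) (Nm ^~ w) (Np ^~ w) (G n w)]].
have B0q : ((P n)^*%mu B0 <= 0%:E)%E by rewrite (outer_negligible ae).
have NpP i : unit_poisson_process (P n) (Np i) by have [] := NP i.
have [B1 HB1 good1] := poisson_sum_excess m NpP a8 na0.
have [B2 HB2 good2] := poisson_sum_excess m NpP A28 ne0.
rewrite scale in HB1; rewrite scale in HB2.
exists (B0 `|` ([set w | (delta%:E < lp_dist 1%E (G n w 0%R) r)%E] `|` (B1 `|` B2))).
  apply: (@le_trans _ _ (0 + (kappa / 4 + (kappa / 4 + kappa / 4)))%:E); last first.
    by rewrite lee_fin.
  do 3 apply: outer_leU => //.
    by apply: le_trans HB1 _; rewrite lee_fin.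
  by apply: le_trans HB2 _; rewrite lee_fin.
move=> w /not_orP[/contrapT path /not_orP[/negP + /not_orP[B1w B2w]]] M t tT.
rewrite -leNgt => Gr.
have {}path : jsq_path n (d n) (lambda n) (Nm ^~ w) (Np ^~ w) (G n w) by exact: path.
have lam_n0 : 0 <= lambda n by exact/ltW/lambda_gt0.
have [z1 [z10 z1x HN1]] := good1 w B1w.
have [z2 [z20 z2x HN2]] := good2 w B2w.
have Gr' j : \sum_(0 <= i < j) `|G n w 0 i - r i| <= delta.
  by rewrite -lee_fin; apply: le_trans (partial_sum_le_lp_dist1 _ _ j) _.
have GS j : \sum_(0 <= i < j) G n w 0 i <= S.
  apply: (@le_trans _ _ (\sum_(0 <= i < j) (`|r i| + `|G n w 0 i - r i|))).
    apply: ler_sum => i _; rewrite -lerBlDl; apply: le_trans (ler_norm _).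
    by rewrite lerD2l lerN2 ler_norm.
  rewrite big_split /= lerD//; apply: le_trans (Gr' j) _.
  by rewrite ge_min lexx.
have G0tail : \sum_(K.+1 <= i < M) G n w 0 i <= eps / 4 + eps / 4.
  apply: (@le_trans _ _ (\sum_(K.+1 <= i < M) (`|r i| + `|G n w 0 i - r i|))).
    apply: ler_sum => i _; rewrite -lerBlDl; apply: le_trans (ler_norm _).
    by rewrite lerD2l lerN2 ler_norm.
  rewrite big_split /= lerD//.
    by apply: HNr; rewrite leqW// leq_maxr.
  apply: (@le_trans _ _ delta); last by rewrite ge_min lexx orbT.
  have [KM|MK] := leqP K.+1 M; last by rewrite big_geq ?(ltnW MK)// ltW.
  apply: le_trans (Gr' M); rewrite [leRHS](@big_cat_nat _ _ _ K.+1)//= lerDr.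
  by apply: sumr_ge0.
have := @jsq_path_tail _ _ _ _ _ _ _ n_gt0 dn' lam_n0 path T0 S a a A2 (eps / 4) C Lam
  z1 z2 m (ltW T0_gt0) (ltW a0) (ltW A20) lL GS z10 z1x HN1 z20 z2x HN2 (lexx _) Cm
  K M t KC tT.
move/le_trans; apply; rewrite mulrA.
(* A quarter each for the tail of [r], the distance of the initial state from [r], the overflow past
   [K] and the Poisson excess. *)
apply: (@le_trans _ _ (eps / 4 + eps / 4 + eps / 4 + eps / 4)).
  by rewrite lerD2r lerD.
by rewrite -!mulrDl; lra.
Unshelve. all: by end_near. Qed.

(* The properties that limits of good sample paths inherit. *)
Definition fluid_candidate (g v : R -> nat -> R) : Prop :=
  [/\ forall T0, 0 <= T0 -> forall e : R, 0 < e -> approx_solution lam r T0 e g v,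
      forall t, 0 <= t -> forall i, g t i.+1 <= g t i,
      forall i, v 0 i = 0
    & forall i s t, 0 <= s -> s <= t ->
        0 <= v t i - v s i <= (lam + 1) * (t - s)].

Lemma fluid_candidate_exists : exists g v, fluid_candidate g v.
Proof.
have fam (k : nat) : exists GV : (R -> nat -> R) * (R -> nat -> R),
    [/\ approx_solution lam r k.+1%:R (2 ^- k) GV.1 GV.2,
        forall t, 0 <= t -> l1_down (GV.1 t),
        forall i, GV.2 0 i = 0
      & forall i s t, 0 <= s -> s <= t ->
          0 <= GV.2 t i - GV.2 s i <= (lam + 1) * (t - s)].
  have k0 : 0 < k.+1%:R :> R by [].
  have e0 : 0 < 2 ^- k :> R by rewrite invr_gt0 exprn_gt0.
  (* Any probability below 1 would do, since one good sample point is enough. *)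
  have q0 : 0 < 2^-1 :> R by rewrite invr_gt0.
  have q1 : 2^-1 < 1 :> R by rewrite invf_lt1// ltr1n.
  have [n [B HB good]] := filter_ex (jsq_near_fluid k0 e0 q0).
  have [w /good[V ?]] := outer_lt1_not_full q1 HB.
  by exists (G n w, V).
have [GV HGV] := choice fam.
pose g t i := limn (fun k => (GV k).1 t i).
pose v t i := limn (fun k => (GV k).2 t i).
pose C T0 : R := 8 * expR (24 * T0).
have C0 T0 : 0 <= C T0 by rewrite mulr_ge0// expR_ge0.
have restr T0 k : (Num.truncn T0 <= k)%N ->
    approx_solution lam r T0 (2 ^- k) (GV k).1 (GV k).2.
  move=> Tk; have [aGV _ _ _] := HGV k; apply: approx_solution_weaken (lexx _) aGV.
  by apply: le_trans (ltW (truncnS_gt _)) _; rewrite ler_nat ltnS.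
have cauchy T0 i t : 0 <= t <= T0 ->
    let k0 := Num.truncn T0 in
    [/\ (GV k).1 t i @[k --> \oo] --> g t i,
        forall k, (k0 <= k)%N -> `|(GV k).1 t i - g t i| <= C T0 * 2 ^+ i * 2 ^- k,
        (GV k).2 t i @[k --> \oo] --> v t i
      & forall k, (k0 <= k)%N -> `|(GV k).2 t i - v t i| <= C T0 * 2 ^+ i * 2 ^- k].
  move=> /[dup] tT /andP[t0 tT'] k0.
  have T00 : 0 <= T0 by exact: le_trans tT'.
  have c0 : 0 <= C T0 * 2 ^+ i by rewrite mulr_ge0// exprn_ge0.
  have st k l : (k0 <= k)%N -> (k0 <= l)%N ->
      `|(GV k).1 t i - (GV l).1 t i| <= C T0 * 2 ^+ i * (2 ^- k + 2 ^- l) /\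
      `|(GV k).2 t i - (GV l).2 t i| <= C T0 * 2 ^+ i * (2 ^- k + 2 ^- l).
    move=> kk kl; have := stability T00 (restr T0 k kk) (restr T0 l kl) i tT.
    by rewrite mulrAC.
  have [h1 h2] := geometric_cauchy_limit c0 (fun k l kk kl => (st k l kk kl).1).
  by have [h3 h4] := geometric_cauchy_limit c0 (fun k l kk kl => (st k l kk kl).2).
have gcvg i t : 0 <= t -> (GV k).1 t i @[k --> \oo] --> g t i.
  by move=> t0; have tt : 0 <= t <= t by [rewrite t0 lexx]; have [] := cauchy t i t tt.
have vcvg i t : 0 <= t -> (GV k).2 t i @[k --> \oo] --> v t i.
  by move=> t0; have tt : 0 <= t <= t by [rewrite t0 lexx]; have [] := cauchy t i t tt.
have g01 i t : 0 <= t -> 0 <= g t i <= 1.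
  move=> t0; apply/andP; split.
    apply: (@cvgr_to_ge _ _ _ _ _ _ _ (gcvg i t t0)); apply: nearW => k.
    by have [_ /(_ t t0)[_ _ /(_ i)/andP[]]] := HGV k.
  apply: (@cvgr_to_le _ _ _ _ _ _ _ (gcvg i t t0)); apply: nearW => k.
  by have [_ /(_ t t0)[_ _ /(_ i)/andP[]]] := HGV k.
exists g, v; split.
- move=> T0 T00 e e0.
  pose D := 1 + (3 + 3 * T0) * C T0.
  have D0 : 0 <= D by rewrite addr_ge0// mulr_ge0// addr_ge0// mulr_ge0.
  have half : 0 <= (2^-1 : R) < 1 by rewrite invr_ge0 ler0n/= invf_lt1// ltr1n.
  have small : \forall k \near \oo, D * 2^-1 ^+ k <= e.
    exact: (@eventually_expr_le _ id).
  have [k [De Tk]] := filter_ex (filterI small (nbhs_infty_ge (Num.truncn T0))).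
  apply: (@approx_solution_weaken _ _ _ T0 T0
      (2 ^- k + (3 + 3 * T0) * (C T0 * 2 ^- k))) => //.
    apply: le_trans De; rewrite exprVn /D; lra.
  apply: approx_solution_perturb (restr T0 k Tk) _ _ _ _ => //.
  (* The shift drops the sample paths whose horizon [k.+1] may be shorter than [T0]. *)
  + move=> i; pose h m := (GV (m + Num.truncn T0)%N).1 ^~ i.
    apply: (@measurable_fun_cvg _ _ _ _ h) => [m|t].
      have [mG _ _ _ _] := restr T0 (m + Num.truncn T0)%N (leq_addl _ _).
      exact: mG.
    rewrite /= in_itv /= => /andP[t0 _].
    have := gcvg i t t0.
    by rewrite -(cvg_shiftn (Num.truncn T0)).
  + by move=> i t /andP[t0 _]; exact: g01.
  + by move=> i t tT; have [_ H _ _] := cauchy T0 i t tT; rewrite mulrAC; exact: H.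
  + by move=> i t tT; have [_ _ _ H] := cauchy T0 i t tT; rewrite mulrAC; exact: H.
- move=> t t0 i; apply: (ler_cvg_to (gcvg i.+1 t t0) (gcvg i t t0)).
  by apply: nearW => k; have [_ /(_ t t0)[]] := HGV k.
- move=> i; rewrite /v; apply/cvg_lim => //.
  apply: (@cvg_trans _ (0 @[k --> \oo])); last exact: cvg_cst.
  by apply: near_eq_cvg; apply: nearW => k; have [_ _ ->] := HGV k.
- move=> i s t s0 st.
  have H : (GV k).2 t i - (GV k).2 s i @[k --> \oo] --> v t i - v s i.
    exact: cvgB (vcvg i t (le_trans s0 st)) (vcvg i s s0).
  apply/andP; split.
    apply: (@cvgr_to_ge _ _ _ _ _ _ _ H); apply: nearW => k.
    by have [_ _ _ /(_ i s t s0 st)/andP[]] := HGV k.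
  apply: (@cvgr_to_le _ _ _ _ _ _ _ H); apply: nearW => k.
  by have [_ _ _ /(_ i s t s0 st)/andP[]] := HGV k.
Qed.

(** [K] is fixed before [M]. Given [M], two bad events of probability at most [1 / 4] leave a sample
    path that obeys the tail bound and differs from [g] by at most [e] in total over the coordinates
    from [K] up to [M]. *)
Lemma fluid_candidate_tail g v (T0 eps : R) : fluid_candidate g v -> 0 < T0 ->
  0 < eps -> exists K : nat, forall M t, 0 <= t <= T0 ->
    \sum_(K <= i < M) g t i <= eps.
Proof.
have alg (a b c y : R) : y * (a + a) * b * c = y * 2 * b * c * a by lra.
move=> [ga _ _ _] T0_gt0 eps0.
have q0 : 0 < 4^-1 :> R by rewrite invr_gt0.
have [K HK] := jsq_tail T0_gt0 eps0 q0.
exists K => M t tT; apply/ler_addgt0Pr => e e0.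
pose C : R := 8 * expR (24 * T0).
have C0 : 0 < C by rewrite mulr_gt0// expR_gt0.
(* [x * eta] is the stability bound summed over [M] coordinates of weight at most [2 ^+ M]; the
   factor 2 comes from taking both errors equal to [eta]. *)
pose x := C * 2 * 2 ^+ M * M%:R.
have x0 : 0 < x + 1 by rewrite ltr_wpDl// !mulr_ge0 ?exprn_ge0// ltW.
pose eta := e / (x + 1).
have eta0 : 0 < eta by rewrite divr_gt0.
have [n [[B1 HB1 good1] [B2 HB2 good2]]] :=
  filter_ex (filterI HK (jsq_near_fluid T0_gt0 eta0 q0)).
have half1 : 4^-1 + 4^-1 < 1 :> R by lra.
have [w /not_orP[w1 w2]] := outer_lt1_not_full half1 (outer_leU HB1 HB2).
have [V [aV _ _ _]] := good2 w w2.
have st := stability (ltW T0_gt0) aV (ga T0 (ltW T0_gt0) eta eta0).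
apply: (@le_trans _ _ (\sum_(K <= i < M) (G n w t i + `|G n w t i - g t i|))).
  apply: ler_sum => i _; rewrite -lerBlDl distrC.
  by apply: le_trans (ler_norm _) _; rewrite lexx.
rewrite big_split /= lerD//; first exact: good1.
have b0 : 0 <= C * (eta + eta) * 2 ^+ M.
  by apply: mulr_ge0; [apply: mulr_ge0; [exact: ltW|exact/ltW/addr_gt0]|rewrite exprn_ge0].
apply: (@le_trans _ _ (\sum_(0 <= i < M) (C * (eta + eta) * 2 ^+ M))).
  have [KM|MK] := leqP K M; last first.
    by rewrite [leLHS]big_geq ?(ltnW MK)// sumr_ge0.
  rewrite [leRHS](@big_cat_nat _ _ _ K)//= -[leLHS]add0r lerD ?sumr_ge0//.
  rewrite big_nat [leRHS]big_nat; apply: ler_sum => i /andP[_ iM].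
  apply: le_trans (st i t tT).1 _.
  rewrite ler_wpM2l ?ler_eXn2l ?ltr1n// ?(ltnW iM)//.
  by apply: mulr_ge0; [exact: ltW|exact/ltW/addr_gt0].
rewrite sumr_const_nat subn0 -[leLHS]mulr_natr.
have -> : C * (eta + eta) * 2 ^+ M * M%:R = x * eta.
  exact: alg.
by rewrite /eta mulrCA ler_piMr ?(ltW e0)// ler_pdivrMr// mul1r lerDl.
Qed.

(** By the exact equation [g] is the free path minus [v]: the outflow has slope at most 1, and the
    incoming and outgoing overflows at most [lam + 1] each. *)
Lemma fluid_candidate_lipschitz g v i s t : fluid_candidate g v ->
  0 <= s -> 0 <= t -> `|g s i - g t i| <= (1 + 2 * (lam + 1)) * `|s - t| /\
    `|v s i - v t i| <= (lam + 1) * `|s - t|.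
Proof.
move=> [ga _ _ vL]; have Lam0 : 0 < lam + 1 by rewrite addr_gt0.
have ex := approx_solution_exact ga.
have vabs j : forall s t, 0 <= s -> s <= t -> `|v t j - v s j| <= (lam + 1) * (t - s).
  by move=> {}s {}t s0 st; have /andP[? ?] := vL j s t s0 st; rewrite ger0_norm.
move: s t => s0 t0 s00 t00; split; last exact: lipschitz_norm (vabs i) _ _ s00 t00.
apply: (lipschitz_norm (f := g ^~ i)) => // {s0 t0 s00 t00} s t s0 st.
have t0 := le_trans s0 st.
have gE u : 0 <= u -> g u i = free_path lam r g v i u - v u i.
  by move=> u0; have [-> ->] := ex i u u0.
rewrite !gE// /free_path.
have [mg g01 _ _ _] := ga t t0 1 ltr01.
have [h1 h2] : - 1 * (t - s) <= \int[@lebesgue_measure R]_(u in `[0, t]) (g u i - g u i.+1)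
    - \int[@lebesgue_measure R]_(u in `[0, s]) (g u i - g u i.+1) /\
    \int[@lebesgue_measure R]_(u in `[0, t]) (g u i - g u i.+1)
    - \int[@lebesgue_measure R]_(u in `[0, s]) (g u i - g u i.+1) <= 1 * (t - s).
  apply/andP; apply: (@Rintegral_increment_bounds _ s t _ _ _ 1) => //.
  - exact: measurable_funB.
  - by move=> u ut; have := g01 i u ut; have := g01 i.+1 u ut; rewrite ler_norml; lra.
  - move=> u /andP[su ut]; have u0t : 0 <= u <= t by rewrite ut (le_trans s0 (ltW su)).
    by have := g01 i u u0t; have := g01 i.+1 u u0t; lra.
have h3 : `|v_pred lam v i t - v_pred lam v i s| <= (lam + 1) * (t - s).
  case: i {gE h1 h2} => [|i] /=; last exact: vabs.
  rewrite -mulrBr ger0_norm ?mulr_ge0 ?subr_ge0 ?(ltW lam_gt0)//.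
  by rewrite ler_wpM2r ?subr_ge0// lerDl.
have h4 := vabs i s t s0 st.
move: h1 h2 h3 h4.
set I1 := Rintegral _ _ _; set I2 := Rintegral _ _ _.
rewrite !ler_norml; lra.
Qed.

Lemma fluid_candidate_solution g v : fluid_candidate g v -> fluid_solution lam r g v.
Proof.
move=> gv; have [ga gd v0 vL] := gv.
have Lam0 : 0 < lam + 1 by rewrite addr_gt0.
have g01 i t : 0 <= t -> 0 <= g t i <= 1.
  by move=> t0; have [_ H _ _ _] := ga t t0 1 ltr01; apply: H; rewrite t0 lexx.
have near_pt (t e : R) : 0 < e -> \forall s \near t, `|s - t| <= e.
  move=> e0; have /cvgrPdist_le/(_ e e0) := @cvg_id _ (nbhs t).
  by apply: filterS => s; rewrite distrC.
split.
(* The horizon [t + 1] leaves room for all [s] within 1 of [t], so one tail bound serves [g s] and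
   [g t]; the first [K] coordinates share a Lipschitz constant. *)
- move=> t t0; have t1 : 0 < t + 1 by rewrite ltr_wpDl.
  split.
    split; [|exact: gd|by move=> i; exact: g01].
    have [K HK] := fluid_candidate_tail gv t1 ltr01.
    apply: (@lp_space1_le _ _ (K%:R * 1 + 1)) => n.
    apply: sum_le_head_tail => // [i _|M].
      by have /andP[? ?] := g01 i t t0; rewrite ger0_norm.
    have -> : \sum_(K <= i < M) `|g t i| = \sum_(K <= i < M) g t i.
      by apply: eq_bigr => i _; have /andP[? _] := g01 i t t0; rewrite ger0_norm.
    by apply: HK; rewrite t0 lerDl ler01.
  apply: cvge0_of_le => [s|e e0]; first exact: lp_dist_ge0.
  have e40 : 0 < e / 4 by rewrite divr_gt0.
  have [K HK] := fluid_candidate_tail gv t1 e40.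
  pose Lg := 1 + 2 * (lam + 1).
  have Lg0 : 0 < Lg by rewrite addr_gt0// mulr_gt0.
  have KL0 : 0 < K%:R * Lg + 1 by rewrite ltr_wpDl// mulr_ge0// ltW.
  pose dd := Num.min 1 (e / 2 / (K%:R * Lg + 1)).
  have dd0 : 0 < dd by rewrite lt_min ltr01 divr_gt0// divr_gt0.
  suff : \forall s \near t, 0 <= s -> (lp_dist 1%E (g s) (g t) <= e%:E)%E by [].
  apply: filterS (near_pt t dd dd0) => s; rewrite le_min => /andP[st1 std] s0.
  apply: lp_dist1_le => n.
  apply: (@le_trans _ _ (K%:R * (Lg * `|s - t|) + (e / 4 + e / 4))).
    apply: sum_le_head_tail => //.
    + by rewrite mulr_ge0// ltW.
    + by move=> i _; have [] := fluid_candidate_lipschitz i gv s0 t0.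
    + move=> M; apply: (@le_trans _ _ (\sum_(K <= i < M) (g s i + g t i))).
        apply: ler_sum => i _; apply: le_trans (ler_normB _ _) _.
        by rewrite !ger0_norm//; [case/andP: (g01 i t t0)|case/andP: (g01 i s s0)].
      rewrite big_split /= lerD// HK// ?t0 ?s0 ?lerDl//=.
      by move: st1; rewrite ler_norml; lra.
  have : K%:R * (Lg * `|s - t|) <= e / 2.
    move: std; rewrite ler_pdivlMr// mulrDr mulr1 => h.
    rewrite mulrA mulrC; have := normr_ge0 (s - t); lra.
  lra.
- move=> t t0; split.
    apply: (@lp_space_oo_le _ _ ((lam + 1) * t)) => i.
    have /andP[h1 h2] := vL i 0 t (lexx 0) t0; rewrite v0 !subr0 in h1 h2.
    by rewrite ger0_norm.
  apply: cvge0_of_le => [s|e e0]; first exact: lp_dist_ge0.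
  have dd0 : 0 < e / (lam + 1) by rewrite divr_gt0.
  suff : \forall s \near t, 0 <= s -> (lp_dist +oo%E (v s) (v t) <= e%:E)%E by [].
  apply: filterS (near_pt t _ dd0) => s st s0.
  apply: lp_dist_oo_le => i.
  apply: le_trans (fluid_candidate_lipschitz i gv s0 t0).2 _.
  by rewrite mulrC -ler_pdivlMr.
- exact: approx_solution_exact.
Qed.

Lemma fluid_candidate_limit g v : fluid_candidate g v ->
  cvg_in_probability P (skorohod_dist (lp_dist 1%E)) G g.
Proof.
have alg (a b c y : R) : c * (y * (a + a) * b) = c * (y * 2 * b) * a by lra.
move=> gv eps eps0; apply: cvge0_of_le => [n|kappa kappa0].
  exact: outer_measure_ge0.
(* Since [1 + T0 / 2 <= expR (T0 / 2)] and [eps * T0 = 8], the term [2 * expR (- (T0 / 2))] is at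
   most [eps / 2]. *)
pose T0 := 8 / eps.
have T0_gt0 : 0 < T0 by rewrite divr_gt0.
have T0e : eps / 2 + 2 * expR (- (T0 / 2)) <= eps.
  have : 2 * expR (- (T0 / 2)) <= eps / 2.
    rewrite expRN ler_pdivrMr ?expR_gt0//.
    have h : 1 + T0 / 2 <= expR (T0 / 2) by exact: expR_ge1Dx.
    have : eps / 2 * (1 + T0 / 2) <= eps / 2 * expR (T0 / 2) by rewrite ler_pM2l ?divr_gt0.
    have : eps * T0 = 8 by rewrite mulrC divfK// gt_eqF.
    lra.
  lra.
have k20 : 0 < kappa / 2 by rewrite divr_gt0.
have e80 : 0 < eps / 8 by rewrite divr_gt0.
have [K1 HK1] := jsq_tail T0_gt0 e80 k20.
have [K2 HK2] := fluid_candidate_tail gv T0_gt0 e80.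
pose K := maxn K1 K2.
pose C : R := 8 * expR (24 * T0).
have C0 : 0 < C by rewrite mulr_gt0// expR_gt0.
pose x := K%:R * (C * 2 * 2 ^+ K).
have x0 : 0 < x + 1.
  by rewrite ltr_wpDl// mulr_ge0// mulr_ge0 ?exprn_ge0// mulr_ge0// ltW.
(* The remaining [eps / 2] is split into [eps / 4] for the first [K] coordinates and [eps / 8] for
   the tail of each of the two paths. *)
pose eta := eps / 4 / (x + 1).
have eta0 : 0 < eta by rewrite !divr_gt0.
have [ga _ _ _] := gv.
apply: filterS2 HK1 (jsq_near_fluid T0_gt0 eta0 k20) => n [B1 HB1 good1] [B2 HB2 good2].
rewrite [kappa]splitr; apply: le_trans (outer_leU HB1 HB2).
apply: le_outer_measure => w; apply: contraPP => /not_orP[w1 w2].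
apply/negP; rewrite -leNgt.
have [V [aV Gl1 _ _]] := good2 w w2.
have st := stability (ltW T0_gt0) aV (ga T0 (ltW T0_gt0) eta eta0).
have e20 : 0 <= eps / 2 by rewrite divr_ge0// ltW.
apply: (@le_trans _ _ (eps / 2 + 2 * expR (- (T0 / 2)))%:E); last by rewrite lee_fin.
apply: skorohod_dist_le_uniform => // [a b||t tT]; first exact: lp_dist_ge0.
  exact: ltW.
have t0 : 0 <= t by case/andP: tT.
have G0 i : 0 <= G n w t i by have [_ _ /(_ i)/andP[]] := Gl1 t t0.
have g0 i : 0 <= g t i.
  by have [_ /(_ i t tT)/andP[]] := ga T0 (ltW T0_gt0) 1 ltr01.
apply: lp_dist1_le => m.
apply: (@le_trans _ _ (K%:R * (C * (eta + eta) * 2 ^+ K) + (eps / 8 + eps / 8))).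
  apply: sum_le_head_tail => //.
  - by apply: mulr_ge0; [apply: mulr_ge0; [exact: ltW|exact/ltW/addr_gt0]|rewrite exprn_ge0].
  - move=> i iK; apply: le_trans (st i t tT).1 _.
    rewrite ler_wpM2l ?ler_eXn2l ?ltr1n// ?(ltnW iK)//.
    by apply: mulr_ge0; [exact: ltW|exact/ltW/addr_gt0].
  - move=> M; apply: (@le_trans _ _ (\sum_(K <= i < M) (G n w t i + g t i))).
      apply: ler_sum => i _; apply: le_trans (ler_normB _ _) _.
      by rewrite !ger0_norm.
    rewrite big_split /= lerD//.
      apply: (@sum_tail_le _ _ _ K1); rewrite ?leq_maxl// => M'.
      exact: good1.
    apply: (@sum_tail_le _ _ _ K2); rewrite ?leq_maxr// => M'.
    exact: HK2.
have -> : K%:R * (C * (eta + eta) * 2 ^+ K) = x * eta.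
  exact: alg.
have : x * eta <= eps / 4.
  rewrite /eta mulrCA ler_piMr ?divr_ge0 ?(ltW eps0)//.
  by rewrite ler_pdivrMr// mul1r lerDl.
lra.
Qed.

End FluidLimitProof.

Unset Implicit Arguments.

Theorem theorem2p3 (R : realType) (disp : nat -> measure_display)
    (T : forall n, measurableType (disp n)) (P : forall n, probability (T n) R)
    (lambda : nat -> R) (d : nat -> nat) (G : forall n, T n -> R -> nat -> R)
    (lam : R) (r : nat -> R)
    (lambda_gt0 : forall n, (0 < n)%N -> 0 < lambda n)
    (d_bound : forall n, (0 < n)%N -> (1 <= d n <= n)%N)
    (G_jsq : forall n, (0 < n)%N ->
      jsq_process (P n) n (d n) (lambda n) (G n))
    (lam_gt0 : 0 < lam)
    (r_l1 : l1_down r)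
    (G0_cvg : cvg_in_probability P (lp_dist 1%E) (fun n w => G n w 0) r)
    (lambda_cvg : lambda n @[n --> \oo] --> lam)
    (d_cvg : d n @[n --> \oo] --> \oo) :
  exists g v : R -> nat -> R,
    [/\ fluid_solution lam r g v,
        forall g' v' : R -> nat -> R, fluid_solution lam r g' v' ->
          forall t : R, 0 <= t -> g' t = g t /\ v' t = v t
      & cvg_in_probability P (skorohod_dist (lp_dist 1%E)) G g].
Proof.
have [g [v gv]] := fluid_candidate_exists lambda_gt0 d_bound G_jsq lam_gt0 r_l1
  G0_cvg lambda_cvg d_cvg.
have sol := fluid_candidate_solution lambda_gt0 d_bound G_jsq lam_gt0 r_l1
  G0_cvg lambda_cvg d_cvg gv.
exists g, v; split => //.
  by move=> g' v'; exact: fluid_solution_unique sol.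
exact: (fluid_candidate_limit lambda_gt0 d_bound G_jsq lam_gt0 r_l1
  G0_cvg lambda_cvg d_cvg gv).
Qed.
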